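(* There exists an algorithm which, given an undirected triangle-free graph $G$ with $n$ nodes, computes an $8/5$-approximation of the girth of $G$ in time $O(n^{1.942})$.
   Context: The girth of a graph is the length of its shortest cycle. An $8/5$-approximation of the girth $g$ is a value $\tilde g$ (the length of a cycle in $G$) with $g \le \tilde g \le \frac{8}{5} g$. A graph is triangle-free if it contains no cycle of length $3$. *)

(* Defs.v *)
From mathcomp Require Import all_boot all_order all_algebra.

Set Implicit Arguments.
Unset Strict Implicit.
Unset Printing Implicit Defensive.

Import Order.TTheory GRing.Theory Num.Theory.

Local Open Scope nat_scope.

Section Girth.
Variables (V : finType) (e : rel V).

Definition has_cycle (k : nat) : Prop :=
  exists c : seq V, [/\ size c = k, 2 < k & ucycle e c].

Definition triangle_free : Prop := ~ has_cycle 3.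

Definition acyclic : Prop := forall k, ~ has_cycle k.

Definition is_girth (g : nat) : Prop :=
  has_cycle g /\ forall k, has_cycle k -> g <= k.

Definition girth_approx (alpha : rat) (t : nat) : Prop :=
  has_cycle t /\
  exists g, [/\ is_girth g, g <= t & (t%:R <= alpha * g%:R :> rat)%R].

(* [adj v] lists the neighbours of [v] once each, in an arbitrary order. *)
Definition adjacency_lists (adj : V -> seq V) : Prop :=
  forall v, uniq (adj v) /\ adj v =i e v.

End Girth.

(* A deterministic unit-cost word RAM. A program has access to registers, whose indices are
   fixed in its code, and to a memory addressed by words. With word length [w],
   every stored value is reduced modulo 2 ^ w. *)

Inductive binop := OpAdd | OpSub | OpMul | OpDiv | OpMod.

Inductive instr :=
  | Halt
  | Const of nat & nat
  | Binop of binop & nat & nat & nat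
  | Read of nat & nat
  | Write of nat & nat
  | Jump of nat
  | JumpLt of nat & nat & nat.

Definition program := seq instr.

Record state := State { pc : nat; reg : nat -> nat; mem : nat -> nat }.

Definition word (w x : nat) : nat := x %% 2 ^ w.

Definition update (f : nat -> nat) (i x : nat) : nat -> nat :=
  fun j => if j == i then x else f j.

(* Division by the zero word follows the library: x %/ 0 = 0, x %% 0 = x. *)
Definition eval_op (w : nat) (o : binop) (x y : nat) : nat :=
  match o with
  | OpAdd => word w (x + y)
  | OpSub => word w (x + 2 ^ w - y)
  | OpMul => word w (x * y)
  | OpDiv => word w (x %/ y)
  | OpMod => word w (x %% y)
  end.

(* Running past the end of the program halts. *)
Definition fetch (P : program) (s : state) : instr := nth Halt P (pc s).

Definition step (w : nat) (P : program) (s : state) : state :=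
  let: State i r m := s in
  match fetch P s with
  | Halt => s
  | Const d k => State i.+1 (update r d (word w k)) m
  | Binop o d a b => State i.+1 (update r d (eval_op w o (r a) (r b))) m
  | Read d a => State i.+1 (update r d (m (r a))) m
  | Write a b => State i.+1 r (update m (r a) (r b))
  | Jump l => State l r m
  | JumpLt a b l => State (if r a < r b then l else i.+1) r m
  end.

Definition halted (P : program) (s : state) : Prop := fetch P s = Halt.

Definition init (w : nat) (input : seq nat) : state :=
  State 0 (fun=> 0) (fun a => word w (nth 0 input a)).

Definition run (w : nat) (P : program) (input : seq nat) (t : nat) : state :=
  iter t (step w P) (init w input).

(* Cell 0 holds n; cell v.+1, for v < n, the address where the list of v
   starts, which is also where the list of the preceding vertex ends; cell
   n.+1 the address where the last list ends; the lists follow. *)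
Definition encode (n : nat) (adj : 'I_n -> seq 'I_n) : seq nat :=
  let lists := [seq [seq val u | u <- adj v] | v <- enum 'I_n] in
  n :: n.+2 :: scanl addn n.+2 (shape lists) ++ flatten lists.

(* Main.v *)
(* Every search is a breadth-first search that stops at the first non-tree edge
   and reports the exact length of the cycle this edge closes with the tree.  If
   a cycle [c] is at distance [d] from the source and the search is not cut short,
   it reports at most [|c| + 2d], plus one if [|c|] is odd.

   Let [b] be about [n^(1/12)].  If too many vertices have degree above [b^7],
   two of them share two neighbours and the girth is 4.  Otherwise each of them
   gets a full search, in time O(n), and is deleted, so that scanning the
   neighbours of any other vertex costs at most [b^7].  Then, for each radius
   [r = 1, 2, 4, ..], as long as some vertex has at least [b] live vertices
   within distance [r], it gets a full search and [b] of these vertices are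
   deleted: a cycle that loses a vertex is at distance at most [r] from the source,
   so it has been approximated up to [2r + 1], and there are at most [n / b] such
   searches.  Afterwards every ball of radius [4r] has at most [b^4] live vertices,
   so searches capped at [b^4 + 1] vertices find every remaining cycle of length
   at most [8r], up to one.  For cycle lengths [g] with [4r <= g < 8r] the
   error, [2r] for even and [2r + 1] for odd [g], is at most [3g/5]; every [g]
   except 3 is in this range for some [r].  The total is
   O(n b^11 log n) = O(n^(23/12) log n). *)

Require Import Defs.
From mathcomp Require Import all_boot zify.

Set Implicit Arguments.
Unset Strict Implicit.
Unset Printing Implicit Defensive.

(** * A structured language and its compilation to the RAM *)

Inductive binstr :=
  | BConst of nat & nat
  | BAdd of nat & nat & nat
  | BMul of nat & nat & nat
  | BInp of nat & nat
  | BGet of nat & nat & nat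
  | BSet of nat & nat & nat.

Inductive cmd :=
  | Blk of seq binstr
  | Seq of cmd & cmd
  | If of nat & nat & cmd & cmd
  | While of nat & nat & cmd.

Record hst := HSt { rg : nat -> nat; ar : nat -> nat -> nat; clk : nat }.

Definition tick (t : nat) (s : hst) : hst := HSt (rg s) (ar s) (t + clk s).

Section Language.
Variables (W base : nat) (inp : nat -> nat).

Definition bstep (s : hst) (i : binstr) : hst :=
  let r := rg s in let a := ar s in let t := clk s in
  match i with
  | BConst d k => HSt (update r d k) a (1 + t)
  | BAdd d x y => HSt (update r d (r x + r y)) a (1 + t)
  | BMul d x y => HSt (update r d (r x * r y)) a (1 + t)
  | BInp d x => HSt (update r d (inp (r x))) a (1 + t)
  | BGet d k x => HSt (update r d (a k (r x))) a (6 + t)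
  | BSet k x y =>
      HSt r (fun k' => if k' == k then update (a k) (r x) (r y) else a k') (6 + t)
  end.

(* The guards exclude overflow, so that [bstep] computes with true naturals. *)
Definition bok1 (s : hst) (i : binstr) : Prop :=
  match i with
  | BConst _ k => k < W
  | BAdd _ x y => rg s x + rg s y < W
  | BMul _ x y => rg s x * rg s y < W
  | BInp _ x => rg s x < base
  | BGet _ k x | BSet k x _ => k < 8 /\ 8 * rg s x + 8 + base < W
  end.

Fixpoint bok (l : seq binstr) (s : hst) : Prop :=
  if l is i :: l' then bok1 s i /\ bok l' (bstep s i) else True.

Inductive exec : cmd -> hst -> hst -> Prop :=
  | ExBlk l s : bok l s -> exec (Blk l) s (foldl bstep s l)
  | ExSeq c1 c2 s1 s2 s3 : exec c1 s1 s2 -> exec c2 s2 s3 -> exec (Seq c1 c2) s1 s3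
  | ExIfT a b c1 c2 s s' : rg s a < rg s b ->
      exec c1 (tick 1 s) s' -> exec (If a b c1 c2) s s'
  | ExIfF a b c1 c2 s s' : rg s b <= rg s a ->
      exec c2 (tick 1 s) s' -> exec (If a b c1 c2) s (tick 1 s')
  | ExWhileT a b c s s1 s2 : rg s a < rg s b ->
      exec c (tick 1 s) s1 -> exec (While a b c) (tick 1 s1) s2 ->
      exec (While a b c) s s2
  | ExWhileF a b c s : rg s b <= rg s a -> exec (While a b c) s (tick 2 s).

Definition wp (c : cmd) (s : hst) (Q : hst -> Prop) : Prop :=
  exists2 s', exec c s s' & Q s'.

Lemma wp_blk l s Q : bok l s -> Q (foldl bstep s l) -> wp (Blk l) s Q.
Proof. by move=> H1 H2; exists (foldl bstep s l) => //; constructor. Qed.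

Lemma wp_seq c1 c2 s Q : wp c1 s (fun s' => wp c2 s' Q) -> wp (Seq c1 c2) s Q.
Proof. by case=> s1 E1 [s2 E2 HQ]; exists s2 => //; apply: ExSeq E1 E2. Qed.

Lemma wp_if a b c1 c2 s Q :
  (rg s a < rg s b -> wp c1 (tick 1 s) Q) ->
  (rg s b <= rg s a -> wp c2 (tick 1 s) (fun s' => Q (tick 1 s'))) ->
  wp (If a b c1 c2) s Q.
Proof.
move=> H1 H2; case: (ltnP (rg s a) (rg s b)) => H.
  by have [s' E HQ] := H1 H; exists s' => //; apply: ExIfT.
by have [s' E HQ] := H2 H; exists (tick 1 s') => //; apply: ExIfF.
Qed.

Lemma wp_conseq c s (Q Q' : hst -> Prop) :
  wp c s Q -> (forall s', Q s' -> Q' s') -> wp c s Q'.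
Proof. by case=> s' E HQ H; exists s' => //; apply: H. Qed.

Lemma bstep_clk s i : clk s < clk (bstep s i).
Proof. by case: s i => r a t [d k|d x y|d x y|d x|d k x|k x y] /=; lia. Qed.

Lemma exec_clk c s s' : exec c s s' -> clk s <= clk s'.
Proof.
elim=> {c s s'} /=; last by move=> *; lia.
- by move=> l s _; elim: l s => //= i l IH s; apply: leq_trans (ltnW (bstep_clk s i)) (IH _).
- by move=> c1 c2 s1 s2 s3 _ H1 _; apply: leq_trans.
- by move=> a b c1 c2 s s' _ _; apply: leq_trans; exact: leq_addl.
- by move=> a b c1 c2 s s' _ _ H; lia.
- by move=> a b c s s1 s2 _ _ H1 _ H2; lia.
Qed.

(* An invariant bounding the clock also proves termination, since every
   iteration advances the clock. *)
Lemma wp_while (Inv : hst -> Prop) (B : nat) a b c s (Q : hst -> Prop) :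
  Inv s ->
  (forall s, Inv s -> clk s <= B) ->
  (forall s, Inv s -> rg s a < rg s b -> wp c (tick 1 s) (fun s' => Inv (tick 1 s'))) ->
  (forall s, Inv s -> rg s b <= rg s a -> Q (tick 2 s)) ->
  wp (While a b c) s Q.
Proof.
move=> Is HB Hb Hq; have [k] := ubnP (B - clk s).
elim: k s Is => // k IH s Is Hk.
case: (ltnP (rg s a) (rg s b)) => H; last first.
  by exists (tick 2 s); [apply: ExWhileF | apply: Hq].
have [s1 E1 I1] := Hb _ Is H.
have [|s2 E2 Q2] := IH (tick 1 s1) I1.
  have := exec_clk E1; have := HB _ Is; have := HB _ I1; rewrite /=; lia.
by exists s2 => //; apply: ExWhileT H E1 E2.
Qed.

Definition bwrites (i : binstr) : seq nat :=
  match i with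
  | BConst d _ | BAdd d _ _ | BMul d _ _ | BInp d _ | BGet d _ _ => [:: d]
  | BSet _ _ _ => [::]
  end.

Fixpoint writes (c : cmd) : seq nat :=
  match c with
  | Blk l => flatten (map bwrites l)
  | Seq c1 c2 | If _ _ c1 c2 => writes c1 ++ writes c2
  | While _ _ c => writes c
  end.

Definition bawrites (i : binstr) : seq nat := if i is BSet k _ _ then [:: k] else [::].

Fixpoint awrites (c : cmd) : seq nat :=
  match c with
  | Blk l => flatten (map bawrites l)
  | Seq c1 c2 | If _ _ c1 c2 => awrites c1 ++ awrites c2
  | While _ _ c => awrites c
  end.

Lemma exec_frame c s s' : exec c s s' ->
  (forall j, j \notin writes c -> rg s' j = rg s j) /\
  (forall k, k \notin awrites c -> ar s' k = ar s k).
Proof.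
elim=> {c s s'}.
- move=> l s _; elim: l s => //= i l IH s; have [IH1 IH2] := IH (bstep s i).
  split=> j; rewrite mem_cat negb_or => /andP[Hj]; [move=> /IH1 -> | move=> /IH2 ->].
    by case: i s Hj {IH IH1 IH2} => [d k|d x y|d x y|d x|d k x|k x y] [r a t] //=;
       rewrite inE /update => /negbTE->.
  by case: i s Hj {IH IH1 IH2} => [d k|d x y|d x y|d x|d k x|k x y] [r a t] //=;
     rewrite inE => /negbTE->.
- move=> c1 c2 s1 s2 s3 _ [A1 A2] _ [B1 B2]; split=> j /=.
    by rewrite mem_cat negb_or => /andP[/A1 <- /B1].
  by rewrite mem_cat negb_or => /andP[/A2 <- /B2].
- move=> a b c1 c2 s s' _ _ [A1 A2]; split=> j /=.
    by rewrite mem_cat negb_or => /andP[/A1].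
  by rewrite mem_cat negb_or => /andP[/A2].
- move=> a b c1 c2 s s' _ _ [A1 A2]; split=> j /=.
    by rewrite mem_cat negb_or => /andP[_ /A1].
  by rewrite mem_cat negb_or => /andP[_ /A2].
- move=> a b c s s1 s2 _ _ [A1 A2] _ [B1 B2]; split=> j /= Hj.
    by rewrite B1 //= A1.
  by rewrite B2 //= A2.
- by [].
Qed.

Lemma wp_frame c s (Q : hst -> Prop) :
  wp c s (fun s' =>
    (forall j, j \notin writes c -> rg s' j = rg s j) ->
    (forall k, k \notin awrites c -> ar s' k = ar s k) -> Q s') ->
  wp c s Q.
Proof.
by case=> s' E H; have [F1 F2] := exec_frame E; exists s' => //; apply: H.
Qed.

End Language.

(* Register 0, 1 are temporaries of the array accesses, register 2 holds
   [base]; cell [i] of array [k] is at address [8 * i + k + base]. *)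
Definition addr_code (k x : nat) : seq instr :=
  [:: Const 0 8; Binop OpMul 0 0 (x + 3); Const 1 k; Binop OpAdd 0 0 1; Binop OpAdd 0 0 2].

Definition bcompile (i : binstr) : seq instr :=
  match i with
  | BConst d k => [:: Const (d + 3) k]
  | BAdd d x y => [:: Binop OpAdd (d + 3) (x + 3) (y + 3)]
  | BMul d x y => [:: Binop OpMul (d + 3) (x + 3) (y + 3)]
  | BInp d x => [:: Read (d + 3) (x + 3)]
  | BGet d k x => addr_code k x ++ [:: Read (d + 3) 0]
  | BSet k x y => addr_code k x ++ [:: Write 0 (y + 3)]
  end.

Fixpoint compile (p : nat) (c : cmd) : seq instr :=
  match c with
  | Blk l => flatten (map bcompile l)
  | Seq c1 c2 => let k1 := compile p c1 in k1 ++ compile (p + size k1) c2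
  | If a b c1 c2 =>
      let k2 := compile p.+1 c2 in
      let q := p.+1 + size k2 in
      let k1 := compile q.+1 c1 in
      JumpLt (a + 3) (b + 3) q.+1 :: k2 ++ Jump (q.+1 + size k1) :: k1
  | While a b c =>
      let k := compile p.+2 c in
      JumpLt (a + 3) (b + 3) p.+2 :: Jump (p.+2 + size k).+1 :: k ++ [:: Jump p]
  end.

Local Arguments step : simpl never.

Section Simulation.
Variables (w base : nat) (inp : nat -> nat) (P : program).
Let W := 2 ^ w.

Definition sim (s : hst) (S : state) : Prop :=
  [/\ forall j, reg S (j + 3) = rg s j, reg S 2 = base,
      forall a, a < base -> Defs.mem S a = inp a &
      forall k i, k < 8 -> Defs.mem S (8 * i + k + base) = ar s k i].

Definition at_pc (p : nat) (l : seq instr) : Prop :=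
  forall i, i < size l -> nth Halt P (p + i) = nth Halt l i.

Lemma at_pc_cat p l1 l2 :
  at_pc p (l1 ++ l2) -> at_pc p l1 /\ at_pc (p + size l1) l2.
Proof.
move=> H; split=> i Hi.
  by rewrite H ?nth_cat ?Hi // size_cat ltn_addr.
rewrite -addnA H ?size_cat ?ltn_add2l // nth_cat ltnNge leq_addr.
by rewrite addKn.
Qed.

Lemma at_pc_cons p x l : at_pc p (x :: l) -> nth Halt P p = x /\ at_pc p.+1 l.
Proof.
move=> H; split; first by rewrite -(addn0 p) H.
by move=> i Hi; rewrite addSnnS H.
Qed.

Definition runs (p : nat) (s : hst) (p' : nat) (s' : hst) : Prop :=
  forall S, sim s S -> pc S = p ->
  let S' := iter (clk s' - clk s) (step w P) S in sim s' S' /\ pc S' = p'.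

Lemma word_small x : x < W -> word w x = x.
Proof. exact: modn_small. Qed.

Lemma runs_trans p1 s1 p2 s2 p3 s3 : clk s1 <= clk s2 -> clk s2 <= clk s3 ->
  runs p1 s1 p2 s2 -> runs p2 s2 p3 s3 -> runs p1 s1 p3 s3.
Proof.
move=> L1 L2 H1 H2 S HS Hp.
have -> : clk s3 - clk s1 = (clk s3 - clk s2) + (clk s2 - clk s1) by lia.
by rewrite iterD; have [A B] := H1 S HS Hp; apply: H2.
Qed.

Lemma update_reg3 r (f : nat -> nat) d x : (forall j, r (j + 3) = f j) ->
  forall j, update r (d + 3) x (j + 3) = update f d x j.
Proof. by move=> H j; rewrite /update eqn_add2r H. Qed.

Lemma sim_reg s r m p p' d x t : sim s (State p r m) ->
  sim (HSt (update (rg s) d x) (ar s) t) (State p' (update r (d + 3) x) m).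
Proof.
case=> A B C D; split=> //=; first exact: update_reg3.
by rewrite /update; case: eqP => //; lia.
Qed.

Lemma step_const p r m d k : nth Halt P p = Const d k ->
  step w P (State p r m) = State p.+1 (update r d (word w k)) m.
Proof. by rewrite /step /fetch /= => ->. Qed.

Lemma step_binop p r m o d a b : nth Halt P p = Binop o d a b ->
  step w P (State p r m) = State p.+1 (update r d (eval_op w o (r a) (r b))) m.
Proof. by rewrite /step /fetch /= => ->. Qed.

Lemma step_read p r m d a : nth Halt P p = Read d a ->
  step w P (State p r m) = State p.+1 (update r d (m (r a))) m.
Proof. by rewrite /step /fetch /= => ->. Qed.

Lemma step_write p r m a b : nth Halt P p = Defs.Write a b ->
  step w P (State p r m) = State p.+1 r (update m (r a) (r b)).
Proof. by rewrite /step /fetch /= => ->. Qed.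

Lemma addr_code_run k x s r m p : sim s (State p r m) -> at_pc p (addr_code k x) ->
  k < 8 -> 8 * rg s x + 8 + base < W ->
  exists r', [/\ iter 5 (step w P) (State p r m) = State (p + 5) r' m,
    sim s (State (p + 5) r' m) & r' 0 = 8 * rg s x + k + base].
Proof.
move=> [A B C D] H Hk Hb; move: A B C D => /= A B C D.
have [E1 {}H] := at_pc_cons H; have [E2 {}H] := at_pc_cons H.
have [E3 {}H] := at_pc_cons H; have [E4 {}H] := at_pc_cons H.
have [E5 _] := at_pc_cons H.
rewrite /= (step_const _ _ E1) (step_binop _ _ E2) (step_const _ _ E3).
rewrite (step_binop _ _ E4) (step_binop _ _ E5) !addnS !addn0.
eexists; split; first by [].
  by split=> //= j; rewrite /update !addnS addn0; move: (A j); rewrite !addnS addn0.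
have U f i v j : update f i v j = if j == i then v else f j by [].
move: (A x); rewrite !U /= !addnS addn0 /= => ->; rewrite B.
have W8 : word w 8 = 8 by apply: word_small; lia.
have Wk : word w k = k by apply: word_small; lia.
rewrite W8 Wk (@word_small (8 * _)); last lia.
by rewrite !word_small; lia.
Qed.

Lemma bcompile_runs i s p : at_pc p (bcompile i) -> bok1 W base s i ->
  runs p s (p + size (bcompile i)) (bstep inp s i).
Proof.
move=> H Hok [q r m] HS /= Hq; subst q; have [A B C D] := HS.
case: s A C D HS Hok => rs a t /= A C D HS Hok.
case: i H Hok => [d k|d x y|d x y|d x|d k x|k x y] H Hok; have H0 := H;
  rewrite [clk _]/=.
- have [E _] := at_pc_cons H.
  rewrite addnK /= (step_const _ _ E) addn1 (word_small Hok); split=> //.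
  exact: sim_reg HS.
- have [E _] := at_pc_cons H.
  rewrite addnK /= (step_binop _ _ E) addn1 !A /= (word_small Hok); split=> //.
  exact: sim_reg HS.
- have [E _] := at_pc_cons H.
  rewrite addnK /= (step_binop _ _ E) addn1 !A /= (word_small Hok); split=> //.
  exact: sim_reg HS.
- have [E _] := at_pc_cons H.
  rewrite addnK /= (step_read _ _ E) addn1 !A C //; split=> //.
  exact: sim_reg HS.
- have [Hk Hx] := Hok; have [H1 H2] := at_pc_cat H.
  have [r' [E S' R0]] := addr_code_run HS H1 Hk Hx.
  have [E' _] := at_pc_cons H2.
  rewrite addnK iterS E (step_read _ _ E') R0 D //; split; last by rewrite /= !addnS addn0.
  exact: sim_reg S'.
- have [Hk Hx] := Hok; have [H1 H2] := at_pc_cat H.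
  have [r' [E S' R0]] := addr_code_run HS H1 Hk Hx.
  have [E' _] := at_pc_cons H2.
  rewrite addnK iterS E (step_write _ _ E') R0; split; last by rewrite /= !addnS addn0.
  have [A' B' C' D'] := S'; split=> //= [b Hb|k' j Hk'].
    by rewrite /update; case: eqP => [|_]; [lia | exact: C'].
  move: A' => /= A'; rewrite /update A'; case: eqP => [Heq|Hne].
    have -> : k' = k by lia.
    by rewrite eqxx; have -> : j == rs x by apply/eqP; lia.
  move: (D' _ j Hk') => /= ->; case: eqP => [Ek|//]; case: eqP => [Ej|]; last by rewrite Ek.
  by case: Hne; rewrite Ek Ej.
Qed.

Lemma runs_jump p s l : nth Halt P p = Jump l -> runs p s l (tick 1 s).
Proof.
by move=> E [q r m] HS /= ->; rewrite addnK /= /step /fetch /= E.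
Qed.

Lemma runs_jumplt p s a b l : nth Halt P p = JumpLt (a + 3) (b + 3) l ->
  runs p s (if rg s a < rg s b then l else p.+1) (tick 1 s).
Proof.
move=> E [q r m] HS /= ->; rewrite addnK /= /step /fetch /= E; split=> //.
by have [A _ _ _] := HS; move: A => /= A; rewrite !A.
Qed.

Lemma compile_runs c s s' p : exec W base inp c s s' -> at_pc p (compile p c) ->
  runs p s (p + size (compile p c)) s'.
Proof.
move=> E; elim: E p => {c s s'}.
- move=> l s Hok p H; elim: l s p Hok H => [|i l IH] s p /=.
    by move=> _ _ S HS Hp /=; rewrite subnn addn0.
  move=> [H1 H2] /at_pc_cat[A1 A2]; rewrite size_cat addnA.
  apply: (@runs_trans _ _ (p + size (bcompile i)) (bstep inp s i)).
  + exact: ltnW (bstep_clk _ _ _).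
  + by apply: (@exec_clk W base inp (Blk l)); constructor.
  + exact: bcompile_runs.
  + exact: IH.
- move=> c1 c2 s1 s2 s3 E1 IH1 E2 IH2 p /= /at_pc_cat[A1 A2]; rewrite size_cat addnA.
  by apply: (runs_trans (exec_clk E1) (exec_clk E2)); [apply: IH1 | apply: IH2].
- move=> a b c1 c2 s s' Hlt E IH p /= /at_pc_cons[A0 /at_pc_cat[_ /at_pc_cons[_ A1]]].
  apply: (@runs_trans _ _ (p.+1 + size (compile p.+1 c2)).+1 (tick 1 s)).
  + exact: leq_addl.
  + exact: exec_clk E.
  + by have := @runs_jumplt _ s _ _ _ A0; rewrite Hlt.
  + have := IH _ A1; congr runs; rewrite size_cat /=; lia.
- move=> a b c1 c2 s s' Hlt E IH p /= /at_pc_cons[A0 /at_pc_cat[A2 /at_pc_cons[A3 _]]].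
  have HE := exec_clk E.
  apply: (@runs_trans _ _ p.+1 (tick 1 s)); [exact: leq_addl | by move: HE => /=; lia | |].
    by have := @runs_jumplt _ s _ _ _ A0; rewrite ltnNge Hlt.
  apply: (@runs_trans _ _ (p.+1 + size (compile p.+1 c2)) s'); [exact: HE | exact: leq_addl | exact: IH |].
  have := @runs_jump _ s' _ A3; congr runs; rewrite size_cat /=; lia.
- move=> a b c s s1 s2 Hlt E1 IH1 E2 IH2 p H.
  have := H => /= /at_pc_cons[A0 /at_pc_cons[_ /at_pc_cat[A1 /at_pc_cons[A2 _]]]].
  have HE1 := exec_clk E1; have HE2 := exec_clk E2; move: HE1 HE2 => /= HE1 HE2.
  apply: (@runs_trans _ _ p.+2 (tick 1 s)); rewrite /=; try lia.
    by have := @runs_jumplt _ s _ _ _ A0; rewrite Hlt.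
  apply: (@runs_trans _ _ (p.+2 + size (compile p.+2 c)) s1); rewrite /=; try lia.
    exact: IH1.
  apply: (@runs_trans _ _ p (tick 1 s1)); rewrite /=; try lia.
    exact: (@runs_jump _ s1 _ A2).
  exact: (IH2 _ H).
- move=> a b c s Hlt p /= /at_pc_cons[A0 /at_pc_cons[A1 _]].
  apply: (@runs_trans _ _ p.+1 (tick 1 s)); rewrite /=; try lia.
    by have := @runs_jumplt _ s _ _ _ A0; rewrite ltnNge Hlt.
  have := @runs_jump _ (tick 1 s) _ A1; congr runs; rewrite ?size_cat /=; try lia.
Qed.

End Simulation.

Definition link (c : cmd) : program :=
  [:: Const 0 0; Read 0 0; Const 1 2; Binop OpAdd 0 0 1; Binop OpMul 2 0 0] ++
  compile 5 c ++ [:: Const 0 0; Binop OpAdd 0 0 3].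

Lemma link_run w n input c s t :
  let base := (n + 2) ^ 2 in
  base < 2 ^ w -> nth 0 input 0 = n -> size input <= base ->
  (forall a, nth 0 input a < 2 ^ w) ->
  exec (2 ^ w) base (nth 0 input) c (HSt (fun=> 0) (fun _ _ => 0) 0) s ->
  rg s 0 < 2 ^ w -> clk s + 7 <= t ->
  let S := run w (link c) input t in halted (link c) S /\ reg S 0 = rg s 0.
Proof.
move=> base Hb Hn Hsz Hin E H0 Ht S; rewrite {}/S /run.
have n_le : n + 2 <= base by rewrite /base; nia.
have wE x : x < 2 ^ w -> word w x = x by exact: modn_small.
have -> : t = (t - (clk s + 7)) + 2 + clk s + 5 by lia.
set P := link c; rewrite !iterD.
have HP i : i < 5 -> nth Halt P i = nth Halt
    [:: Const 0 0; Read 0 0; Const 1 2; Binop OpAdd 0 0 1; Binop OpMul 2 0 0] i.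
  by move=> Hi; rewrite /P /link nth_cat Hi.
have [r [-> R2 R3]] : exists r, [/\ iter 5 (step w P) (init w input)
    = State 5 r (fun a => word w (nth 0 input a)), r 2 = base & forall j, r (j + 3) = 0].
  rewrite /init /= (step_const _ _ _ (HP 0 isT)) (step_read _ _ _ (HP 1 isT)).
  rewrite (step_const _ _ _ (HP 2 isT)) (step_binop _ _ _ (HP 3 isT)).
  rewrite (step_binop _ _ _ (HP 4 isT)); eexists; split; first by [].
    have W2 : word w 2 = 2 by apply: wE; lia.
    have Wn : word w n = n by apply: wE; lia.
    have Wn2 : word w (n + 2) = n + 2 by apply: wE; lia.
    have W0 : word w 0 = 0 by apply: wE; lia.
    by rewrite /update /= /update /= W0 Hn W2 !Wn Wn2 wE.
  by move=> j; rewrite /update !addnS addn0.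
have At : at_pc P 5 (compile 5 c ++ [:: Const 0 0; Binop OpAdd 0 0 3]) by [].
have [At1 At2] := at_pc_cat At.
have [||HS] := compile_runs E At1 (S := State 5 r (fun a => word w (nth 0 input a))).
- split=> //= [a _|k i _]; first by rewrite wE.
  by rewrite nth_default ?wE //; [apply: leq_ltn_trans Hb | lia].
- by [].
move: HS; rewrite /= subn0; case: (iter (clk s) _ _) => p r' m [A _ _ _] /= ->.
have [E1 At3] := at_pc_cons At2; have [E2 _] := at_pc_cons At3.
rewrite (step_const _ _ _ E1) (step_binop _ _ _ E2).
set S := State _ _ _.
have HS : fetch P S = Halt.
  by rewrite /fetch nth_default //= /P /link !size_cat /=; lia.
have -> k : iter k (step w P) S = S.
  by elim: k => //= k ->; rewrite /step HS.
split=> //; move: (A 0) => /= A0; rewrite /S /update /= /update /= A0.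
by rewrite (wE 0) ?wE //; lia.
Qed.

(** * Distances, balls and cycles *)

Section Distance.
Variable E : rel nat.

Definition within (k v x : nat) : Prop :=
  exists p, [/\ path E v p, last v p = x & size p <= k].

Lemma within0 v : within 0 v v.
Proof. by exists [::]. Qed.

Lemma within_leq k k' v x : k <= k' -> within k v x -> within k' v x.
Proof. by move=> Hk [p [H1 H2 H3]]; exists p; split=> //; apply: leq_trans Hk. Qed.

Lemma within_trans k1 k2 v x y :
  within k1 v x -> within k2 x y -> within (k1 + k2) v y.
Proof.
move=> [p [H1 H2 H3]] [p' [H1' H2' H3']]; exists (p ++ p').
by rewrite cat_path H1 H2 H1' last_cat H2 H2' size_cat leq_add.
Qed.

Lemma within_split k1 k2 v y : within (k1 + k2) v y ->
  exists2 x, within k1 v x & within k2 x y.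
Proof.
move=> [p [H1 H2 H3]]; move: H1 H2; rewrite -{1 2}(cat_take_drop k1 p).
rewrite cat_path last_cat => /andP[A B] C.
exists (last v (take k1 p)); first by exists (take k1 p); split=> //; rewrite size_take_min; lia.
by exists (drop k1 p); split=> //; rewrite size_drop; lia.
Qed.

Definition small (k v m : nat) : Prop :=
  exists2 s : seq nat, size s <= m & forall x, within k v x -> x \in s.

Lemma small_size k v m s : small k v m -> uniq s ->
  (forall x, x \in s -> within k v x) -> size s <= m.
Proof.
by move=> [s' Hs Hin] Us Hw; apply: leq_trans Hs; apply: uniq_leq_size => // x /Hw/Hin.
Qed.

Lemma small_mul (P : pred nat) b B :
  (forall x y, P x -> E x y -> P y) -> (forall x, P x -> small b x B) ->
  forall j v, P v -> small (j * b) v (B ^ j).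
Proof.
move=> HP HB; elim=> [|j IH] v Pv.
  exists [:: v] => // x [[|? ?] [_ //= -> _]]; exact: mem_head.
have [s Hs Hin] := HB v Pv.
have [s' Hs' Hin'] : exists2 s', size s' <= size s * B ^ j &
    forall u x, u \in s -> P u -> within (j * b) u x -> x \in s'.
  elim: s {Hs Hin} => [|u s [s' Hs' Hin']]; first by exists [::].
  case Pu: (P u); last first.
    exists s' => [|w x]; first by rewrite /= mulSn; apply: leq_trans Hs' (leq_addl _ _).
    rewrite inE => /orP[/eqP->|]; last exact: Hin'.
    by rewrite Pu.
  have [s2 Hs2 Hin2] := IH u Pu; exists (s2 ++ s') => [|w x].
    by rewrite size_cat /= mulSn leq_add.
  rewrite inE mem_cat => /orP[/eqP-> _ /Hin2 -> //|Hw Pw Hx].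
  by rewrite (Hin' w) ?orbT.
exists s' => [|x].
  by apply: leq_trans Hs' _; rewrite expnS leq_mul2r Hs orbT.
rewrite mulSn => /within_split[u Hu Hx]; apply: (Hin' u) => //; first exact: Hin.
have [p [Hp <- _]] := Hu.
by elim: p v Pv Hp {s Hs Hin s' Hs' Hin' Hu Hx} => //= y p IHp v Pv /andP[/(HP _ _ Pv)]; exact: IHp.
Qed.

Hypothesis Esym : symmetric E.

Lemma cycle_within d v (u : nat) (c : seq nat) : ucycle E c -> u \in c -> within d v u ->
  exists u0, forall x, x \in c ->
    within (d + (size c)./2) v x /\ (x != u0 -> within (d + (size c).-1./2) v x).
Proof.
case/andP=> Hc Uc Hu Hd; have [i c' Hrot] := rot_to Hu.
have Sc : size c = (size c').+1 by rewrite -(size_rot i c) Hrot.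
have Hp : path E u (rcons c' u) by move: Hc; rewrite -(rot_cycle i) Hrot.
have W1 j : j <= size c' -> within j u (nth 0 (u :: c') j).
  move=> Hj; exists (take j c'); split; last by rewrite size_take_min; lia.
    by move: Hp; rewrite rcons_path => /andP[Hp _]; apply: take_path.
  case: j Hj => [|j] Hj; first by rewrite take0.
  by rewrite (last_nth 0) size_takel // -nth_behead /= nth_take.
have W2 j : j <= size c' -> within (size c - j) u (nth 0 (u :: c') j).
  move=> Hj; set x := nth _ _ _.
  have Hx : last u (take j (rcons c' u)) = x.
    case: j Hj @x => [|j] Hj /=; first by rewrite take0.
    rewrite (last_nth 0) size_takel; last by rewrite size_rcons ltnW.
    by rewrite /= nth_take // nth_rcons Hj.
  move: Hp; rewrite -(cat_take_drop j (rcons c' u)) cat_path Hx => /andP[_ Hdp].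
  have Hl : last x (drop j (rcons c' u)) = u.
    have := last_rcons u c' u; rewrite -{1}(cat_take_drop j (rcons c' u)) last_cat Hx.
    by [].
  exists (rev (belast x (drop j (rcons c' u)))); split.
  - rewrite -{1}Hl rev_path; apply: sub_path Hdp => y z; by rewrite Esym.
  - have : 0 < size (drop j (rcons c' u)) by rewrite size_drop size_rcons; lia.
    by case: (drop _ _) => //= y s _; rewrite rev_cons last_rcons.
  - by rewrite size_rev size_belast size_drop size_rcons Sc.
exists (nth 0 (u :: c') (size c)./2) => x; rewrite -(mem_rot i) Hrot => /(nthP 0)[j].
rewrite /= ltnS => Hj <-.
have [Hj2|Hj2] := leqP j (size c)./2.
  split=> [|Hne]; first by apply: within_trans Hd (within_leq Hj2 (W1 _ Hj)).
  apply: within_trans Hd (within_leq _ (W1 _ Hj)).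
  have : j != (size c)./2 by apply: contraNneq Hne => ->.
  lia.
by split=> [|_]; apply: within_trans Hd (within_leq _ (W2 _ Hj)); lia.
Qed.

End Distance.

Lemma forest_acyclic (E : rel nat) (pos pa : nat -> nat) (c : seq nat) :
  symmetric E -> ucycle E c -> 2 < size c ->
  {in c &, injective pos} ->
  {in c &, forall a b, E a b -> pos a < pos b -> pa b = a} -> False.
Proof.
move=> Es /andP[Hc Uc] Sc Hinj Hpa.
have [x Hx Hmax] : exists2 x, x \in c & forall y, y \in c -> pos y <= pos x.
  case: c Sc {Hc Uc Hinj Hpa} => // z c _.
  elim: c z => [|y c IH] z; first by exists z => [|y]; rewrite inE // => /eqP->.
  have [x Hx Hm] := IH y; case: (leqP (pos z) (pos x)) => H.
    by exists x => [|w]; rewrite inE ?Hx ?orbT // => /orP[/eqP->|/Hm].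
  exists z => [|w]; rewrite inE ?eqxx // => /orP[/eqP->//|/Hm].
  by move=> H'; apply: ltnW (leq_ltn_trans H' H).
have [i c' Hrot] := rot_to Hx.
have Hmem y : (y \in c) = (y \in x :: c') by rewrite -Hrot mem_rot.
have Hlt y : y \in c' -> pos y < pos x /\ x != y.
  move=> Hy; have Hyc : y \in c by rewrite Hmem inE Hy orbT.
  have Hxy : x != y.
    have : uniq (x :: c') by rewrite -Hrot rot_uniq.
    by move=> /= /andP[Hn _]; apply: contraNneq Hn => ->.
  split=> //; rewrite ltn_neqAle Hmax // andbT.
  by apply: contraNneq Hxy => /(Hinj _ _ Hyc Hx)->.
have : uniq (x :: c') && cycle E (x :: c') && (2 < size (x :: c')).
  by rewrite -Hrot rot_uniq rot_cycle size_rot Uc Hc.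
case: c' Hrot Hmem Hlt => [|y c'] Hrot Hmem Hlt; first by rewrite andbF.
case/lastP: c' Hrot Hmem Hlt => [|c' z] Hrot Hmem Hlt; first by rewrite andbF.
move=> /andP[/andP[/and3P[_ Hyz _]]] /=.
rewrite rcons_path last_rcons => /andP[Exy /andP[_ Ezx]] _.
have Hy : y \in y :: rcons c' z by rewrite inE eqxx.
have Hz : z \in y :: rcons c' z by rewrite inE mem_rcons inE eqxx orbT.
have Yc : y \in c by rewrite Hmem inE Hy orbT.
have Zc : z \in c by rewrite Hmem inE Hz orbT.
have e1 := Hpa _ _ Yc Hx; have e2 := Hpa _ _ Zc Hx.
rewrite Es in Exy.
move: Hyz; rewrite -{1}(e1 Exy (Hlt _ Hy).1) (e2 Ezx (Hlt _ Hz).1).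
by rewrite mem_rcons inE eqxx.
Qed.

(** * Breadth-first search trees *)

(* Queue indices start at 1; [q i], [par i], [dep i] are the vertex, the index
   of its parent in the tree and its depth, and [par 1 = 0]. *)
Record bfs_tree (E : rel nat) (v tail : nat) (q par dep : nat -> nat) : Prop := BfsTree {
  bt_tail : 0 < tail;
  bt_q1 : q 1 = v;
  bt_par1 : par 1 = 0;
  bt_dep1 : dep 1 = 0;
  bt_inj : forall i j, 0 < i <= tail -> 0 < j <= tail -> q i = q j -> i = j;
  bt_par : forall i, 1 < i <= tail -> 0 < par i < i;
  bt_edge : forall i, 1 < i <= tail -> E (q (par i)) (q i);
  bt_dep : forall i, 1 < i <= tail -> dep i = (dep (par i)).+1;
  bt_mono : forall i j, 0 < i <= j -> j <= tail -> dep i <= dep j }.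

Definition tree_edge (par : nat -> nat) (i j : nat) : bool := (par j == i) || (par i == j).

Definition processed (E : rel nat) tail (q par : nat -> nat) (i : nat) : Prop :=
  forall y, E (q i) y -> exists2 j, 0 < j <= tail & q j = y /\ tree_edge par i j.

Section Tree.
Variables (E : rel nat) (v tail : nat) (q par dep : nat -> nat).
Hypothesis T : bfs_tree E v tail q par dep.

Lemma bt_within i : 0 < i <= tail -> within E (dep i) v (q i).
Proof.
elim/ltn_ind: i => i IH Hi; have [Hi1|Hi1] := leqP i 1.
  have -> : i = 1 by lia.
  by rewrite (bt_q1 T) (bt_dep1 T); exact: within0.
have Hp : 1 < i <= tail by lia.
have P1 := bt_par T Hp; have := bt_dep T Hp; rewrite -addn1 => ->.
apply: (@within_trans _ _ _ _ (q (par i))); first by apply: IH; lia.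
by exists [:: q i]; rewrite /= (bt_edge T Hp).
Qed.

Lemma bt_dep_lt i : 0 < i <= tail -> dep i < i.
Proof.
elim/ltn_ind: i => i IH Hi; have [Hi1|Hi1] := leqP i 1.
  have -> : i = 1 by lia.
  by rewrite (bt_dep1 T).
have Hp : 1 < i <= tail by lia.
have P1 := bt_par T Hp; rewrite (bt_dep T Hp).
by apply: leq_ltn_trans (IH (par i) _ _) _; lia.
Qed.

Lemma reach K p :
  (forall i, 0 < i <= tail -> dep i <= K -> processed E tail q par i) ->
  path E v p -> size p <= K.+1 ->
  exists2 i, 0 < i <= tail & q i = last v p /\ dep i <= size p.
Proof.
move=> HK; elim/last_ind: p => [|p x IH].
  exists 1; first by rewrite (bt_tail T).
  by rewrite (bt_q1 T) (bt_dep1 T).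
rewrite rcons_path size_rcons last_rcons ltnS => /andP[Hp He] Hs.
have [i Hi [Hq Hd]] := IH Hp (leqW Hs).
have [|j Hj [<- Ht]] := HK i Hi (leq_trans Hd Hs) x; first by rewrite Hq.
exists j => //; split=> //.
have Hex k : 0 < k <= tail -> par k != 0 -> 1 < k <= tail.
  by move=> Hk; case: k Hk => [//|[|//]]; rewrite (bt_par1 T).
case/orP: Ht => /eqP Hpar.
  by rewrite (bt_dep T) ?Hpar ?ltnS // ; apply: Hex; rewrite // Hpar; lia.
have H1 : 1 < i <= tail by apply: Hex; rewrite // Hpar; lia.
by have := bt_dep T H1; rewrite Hpar; lia.
Qed.

Lemma reach_within K x :
  (forall i, 0 < i <= tail -> dep i <= K -> processed E tail q par i) ->
  within E K.+1 v x -> exists2 i, 0 < i <= tail & q i = x /\ dep i <= K.+1.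
Proof.
move=> HK [p [Hp Hl Hs]]; have [i Hi [Hq Hd]] := reach HK Hp Hs.
by exists i => //; rewrite Hq; split=> //; apply: leq_trans Hs.
Qed.

Lemma reach_within_le K x :
  (forall i, 0 < i <= tail -> dep i <= K -> processed E tail q par i) ->
  forall k, k <= K.+1 -> within E k v x -> exists2 i, 0 < i <= tail & q i = x /\ dep i <= k.
Proof.
move=> HK k Hk [p [Hp Hl Hs]]; have [i Hi [Hq Hd]] := reach HK Hp (leq_trans Hs Hk).
by exists i => //; rewrite Hq; split=> //; apply: leq_trans Hs.
Qed.

Lemma small_queue K :
  (forall i, 0 < i <= tail -> dep i < K -> processed E tail q par i) ->
  small E K v tail.
Proof.
move=> HK; exists (map q (iota 1 tail)); first by rewrite size_map size_iota.
case: K HK => [_ x [[|? ?] [_ //= <- _]]|K HK x /(reach_within HK)[i Hi [<- _]]].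
  by rewrite -(bt_q1 T) map_f // mem_iota; have := bt_tail T; lia.
by rewrite map_f // mem_iota; lia.
Qed.

Lemma size_queue K m : small E K v m -> (forall i, 0 < i <= tail -> dep i <= K) ->
  tail <= m.
Proof.
move=> Hs Hd; rewrite -(size_iota 1 tail) -(size_map q); apply: small_size Hs _ _.
  rewrite map_inj_in_uniq ?iota_uniq // => i j; rewrite !mem_iota => Hi Hj.
  by apply: (bt_inj T); lia.
move=> x /mapP[i]; rewrite mem_iota => Hi ->.
by apply: within_leq (bt_within _); [apply: Hd; lia | lia].
Qed.

(* [u0] is the vertex of [c] opposite to [u] when [c] is even: the only one
   that may be left unprocessed. *)
Lemma processed_acyclic d u (c : seq nat) : symmetric E ->
  ucycle E c -> 2 < size c -> u \in c -> within E d v u ->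
  (forall i, 0 < i <= tail -> dep i <= d + (size c).-1./2 -> processed E tail q par i) ->
  False.
Proof.
set K := d + _ => Es Hc Sc Hu Hd HK.
have [u0 Hu0] := cycle_within Es Hc Hu Hd.
have pos_ex x : x \in c -> exists2 i, 0 < i <= tail & q i = x.
  move=> /Hu0[Hx _]; have [|i Hi [Hq _]] := reach_within HK (x := x); last by exists i.
  by apply: within_leq Hx; rewrite /K; lia.
pose pos x := index x (map q (iota 1 tail)).
have posP x : x \in c -> [/\ 0 < (pos x).+1 <= tail & q (pos x).+1 = x].
  move=> /pos_ex[i Hi Hq]; have Hx : x \in map q (iota 1 tail).
    by rewrite -Hq map_f // mem_iota; lia.
  have Hlt : pos x < tail by move: (Hx); rewrite -index_mem size_map size_iota.
  split=> //; have := nth_index 0 Hx; rewrite -/(pos x) (nth_map 0) ?size_iota //.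
  by rewrite nth_iota.
apply: (@forest_acyclic E pos (fun x => q (par (pos x).+1)) c) => //.
  by move=> x y Hx Hy Hxy; have [_ <-] := posP x Hx; have [_ <-] := posP y Hy; rewrite Hxy.
move=> a b Ha Hb Hab Hlt; have [Pa Qa] := posP a Ha; have [Pb Qb] := posP b Hb.
have dep_le x : x \in c -> x != u0 -> dep (pos x).+1 <= K.
  move=> Hx Hne; have [_ /(_ Hne) Hw] := Hu0 x Hx.
  have [|i Hi [Hq Hdi]] := reach_within_le HK _ Hw; first by rewrite /K.
  have [Px Qx] := posP x Hx.
  by have <- : i = (pos x).+1 by apply: (bt_inj T) => //; rewrite Hq.
have Da : dep (pos a).+1 <= K.
  have [Ea|] := eqVneq a u0; last exact: dep_le.
  apply: leq_trans (dep_le b Hb _); first by apply: (bt_mono T); lia.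
  by apply: contraTneq Hlt => ->; rewrite Ea ltnn.
have [|j Hj [Hq Ht]] := HK _ Pa Da b; first by rewrite Qa.
have Ej : j = (pos b).+1 by apply: (bt_inj T) => //; rewrite Hq Qb.
case/orP: Ht; rewrite Ej => /eqP Hp; first by rewrite Hp Qa.
have : 0 < par (pos a).+1 < (pos a).+1.
  apply: (bt_par T); case: (pos a) Hp Pa => [|k] //=.
  by rewrite (bt_par1 T).
by rewrite Hp; lia.
Qed.

End Tree.

(* State of the climb from both ends [h], [f] of a non-tree edge to their
   lowest common ancestor: [i] and [j] have been reached after [len - 1] steps. *)
Definition climb_step (par : nat -> nat) : rel nat := fun x y => (1 < x) && (par x == y).

Definition climb (par : nat -> nat) (h f i j len : nat) : Prop :=
  exists p1 p2, [/\ path (climb_step par) h p1 /\ last h p1 = i,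
    path (climb_step par) f p2 /\ last f p2 = j,
    len = (size p1 + size p2).+1,
    uniq (belast h p1 ++ belast f p2) &
    forall x, x \in belast h p1 ++ belast f p2 -> maxn i j < x].

Lemma climb0 par h f : climb par h f h f 1.
Proof. by exists [::], [::]. Qed.

Lemma climbC par h f i j len : climb par h f i j len -> climb par f h j i len.
Proof.
move=> [p1 [p2 [H1 H2 H3 H4 H5]]]; exists p2, p1; split=> //.
- by rewrite addnC.
- by rewrite uniq_catC.
- by move=> x Hx; rewrite maxnC; apply: H5; move: Hx; rewrite !mem_cat orbC.
Qed.

Lemma climb_left par h f i j len : par i < i -> 0 < j < i ->
  climb par h f i j len -> climb par h f (par i) j len.+1.
Proof.
move=> Hp Hji [p1 [p2 [[P1 L1] H2 -> U M]]]; exists (rcons p1 (par i)), p2; split=> //.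
- by rewrite rcons_path last_rcons P1 L1 /= /climb_step eqxx andbT; split=> //; lia.
- by rewrite size_rcons.
- rewrite belast_rcons lastI L1 cat_rcons -cat1s uniq_catCA cat1s /= U andbT.
  by apply/negP => /M; lia.
- move=> x; rewrite belast_rcons lastI L1 cat_rcons !(mem_cat, inE) => H.
  have [->|Hx] := eqVneq x i; first by lia.
  by have := M x; rewrite mem_cat; move: H; rewrite (negbTE Hx) /= => H /(_ H); lia.
Qed.

Lemma climb_right par h f i j len : par j < j -> 0 < i < j ->
  climb par h f i j len -> climb par h f i (par j) len.+1.
Proof. by move=> Hp Hij /climbC/(climb_left Hp Hij)/climbC. Qed.

Lemma climb_cycle (E : rel nat) v tail q par dep h f i len :
  symmetric E -> bfs_tree E v tail q par dep ->
  0 < h <= tail -> 0 < f <= tail -> 0 < i -> h != f -> par h != f -> par f != h ->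
  E (q f) (q h) -> climb par h f i i len ->
  exists c, [/\ size c = len, 2 < len & ucycle E c].
Proof.
move=> Es T Hh Hf Hi Ehf P1 P2 Ee [p1 [p2 [[A1 L1] [A2 L2] Hl U M]]].
set c := f :: (p2 ++ rev (belast h p1)).
have Hc : perm_eq c (i :: belast h p1 ++ belast f p2).
  apply/permP => p; rewrite /c -cat_cons count_cat count_rev lastI L2 -cats1 /=.
  by rewrite !count_cat /=; lia.
have Uc : uniq c.
  rewrite (perm_uniq Hc) /= U andbT; apply/negP => /M; lia.
have Sc : size c = len by rewrite (perm_size Hc) /= size_cat !size_belast Hl.
have chain h' p : 0 < h' <= tail -> 0 < last h' p -> path (climb_step par) h' p ->
    path (relpre q E) h' p /\ all (fun x => 0 < x <= tail) (h' :: p).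
  elim: p h' => [|x p IH] h' Hh' //=; first by rewrite Hh'.
  move=> Hlast /andP[/andP[H1 /eqP Ex] Hp]; rewrite Hh' /=.
  have Hh1 : 1 < h' <= tail by lia.
  have Hx : 0 < x <= tail by have := bt_par T Hh1; rewrite Ex; lia.
  have [E1 E2] := IH x Hx Hlast Hp; split=> //.
  by rewrite E1 andbT Es -Ex (bt_edge T Hh1).
have [C1 _] := chain h p1 Hh (etrans (congr1 (leq 1) L1) Hi) A1.
have [C2 _] := chain f p2 Hf (etrans (congr1 (leq 1) L2) Hi) A2.
exists (map q c); split; first by rewrite size_map.
  rewrite Hl; case: p1 p2 {Hc Uc Sc C1 C2 c U M Hl} A1 L1 A2 L2 => [|x [|y p1]] [|x' [|y' p2]] //=.
  - by move=> _ E0 _ E1; rewrite E0 E1 eqxx in Ehf.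
  - by move=> _ E0 /andP[/andP[_ /eqP E1] _] E2; rewrite E1 E2 E0 eqxx in P2.
  - by move=> /andP[/andP[_ /eqP E1] _] E2 _ E3; rewrite E1 E2 E3 eqxx in P1.
rewrite /ucycle cycle_map; apply/andP; split.
  rewrite /c /= -cats1 -catA cat_path C2 L2 -L1 cats1.
  case: p1 C1 L1 {A1 Hl U M c Hc Uc Sc} => [_ _|x p1 C1 _]; first by rewrite /= Es Ee.
  rewrite rcons_path rev_path /=; apply/andP; split; last first.
    by rewrite rev_cons last_rcons /= Es.
  by have := C1; rewrite (eq_path (e' := fun z => (relpre q E)^~ z)) // => y z; rewrite /= Es.
rewrite map_inj_in_uniq //.
have Hall x : x \in c -> 0 < x <= tail.
  rewrite /c -cat_cons mem_cat mem_rev => /orP[Hx|/mem_belast Hx].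
    by have [_ /allP] := chain f p2 Hf (etrans (congr1 (leq 1) L2) Hi) A2; apply.
  by have [_ /allP] := chain h p1 Hh (etrans (congr1 (leq 1) L1) Hi) A1; apply.
by move=> x y /Hall Hx /Hall Hy; apply: (bt_inj T).
Qed.

Record nat_graph (n : nat) (N : nat -> seq nat) : Prop := NatGraph {
  ng_lt : forall x y, y \in N x -> y < n;
  ng_sym : forall x y, y \in N x -> x \in N y;
  ng_irr : forall x, x \notin N x;
  ng_uniq : forall x, uniq (N x) }.

Definition edge (N : nat -> seq nat) (alive : pred nat) : rel nat :=
  fun x y => [&& y \in N x, alive x & alive y].

Lemma edge_sym n N alive : nat_graph n N -> symmetric (edge N alive).
Proof.
move=> G x y; rewrite /edge andbA andbAC -andbA; congr (_ && (_ && _)).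
by apply/idP/idP; exact: (ng_sym G).
Qed.

Section BfsInvariant.
Variables (n : nat) (N : nat -> seq nat) (alive : pred nat).
Hypothesis G : nat_graph n N.
Variables (v cap D : nat) (full : bool).

(* [head] is the index being scanned, [k] the number of its neighbours already
   scanned, [c] the number of scans so far: at most one scan per vertex meets
   its parent, and all others that do not end the search either enqueue a vertex
   or meet a dead vertex. *)
Record bfs_inv (head tail k c : nat) (pos q par dep : nat -> nat) : Prop := BfsInv {
  bi_tree : bfs_tree (edge N alive) v tail q par dep;
  bi_pos : forall x, 0 < pos x -> pos x <= tail /\ q (pos x) = x;
  bi_posq : forall i, 0 < i <= tail -> pos (q i) = i;
  bi_alive : forall i, 0 < i <= tail -> alive (q i) /\ q i < n;
  bi_cap : tail <= cap;
  bi_head : head <= tail;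
  bi_proc : forall i, 0 < i < head -> processed (edge N alive) tail q par i;
  bi_part : 0 < head -> forall y, y \in take k (N (q head)) -> alive y ->
    exists2 j, 0 < j <= tail & q j = y /\ tree_edge par head j;
  bi_k : k <= if head is 0 then 0 else size (N (q head));
  bi_par : forall j, 1 < j <= tail ->
    par j < head \/ (par j = head /\ q j \in take k (N (q head)));
  bi_dep : if head is 0 then tail = 1 else dep tail <= (dep head).+1;
  bi_cost : c <= if full then tail + head + ((0 < par head) && (q (par head) \in take k (N (q head))))
                 else head.-1 * D + k }.

Hypothesis mode : forall x, x < n -> if full then is_true (alive x) else (alive x -> size (N x) <= D).

Lemma bfs_inv_init pos q par dep : (forall x, pos x = 0) -> v < n -> alive v -> 0 < cap ->
  bfs_inv 0 1 0 0 (update pos v 1) (update q 1 v) (update par 1 0) (update dep 1 0).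
Proof.
move=> Hpos Hv Av Hcap.
have E1 i : 0 < i <= 1 -> i = 1 by lia.
split=> //; rewrite /update /=.
- split=> //; try by move=> i Hi; lia.
  by move=> i j Hi Hj; have -> : i = 1 by lia; have -> : j = 1 by lia.
- by move=> x; case: eqP => [->|_] //; rewrite Hpos.
- by move=> i /E1->; rewrite !eqxx.
- by move=> i /E1->.
- by move=> i; lia.
- by move=> j; lia.
Qed.

Section Step.
Variables (head tail k c : nat) (pos q par dep : nat -> nat).
Hypothesis I : bfs_inv head tail k c pos q par dep.

Lemma bi_tail_le : tail <= n.
Proof.
rewrite -(size_iota 1 tail) -(size_map q) -[X in _ <= X](size_iota 0 n).
apply: uniq_leq_size.
  rewrite map_inj_in_uniq ?iota_uniq // => i j; rewrite !mem_iota => Hi Hj.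
  by apply: (bt_inj (bi_tree I)); lia.
by move=> x /mapP[i]; rewrite !mem_iota => Hi ->; have := bi_alive I (i := i); lia.
Qed.

Lemma bi_iterations : c + head <= (if full then 3 * n else cap * D.+1).+1.
Proof.
have := bi_cost I; have := bi_tail_le; have := bi_head I; have := bi_cap I.
case: full mode => M H1 H2 H3; first by case: (_ && _); lia.
case: head I H2 => [|h] I' H2; have := bi_k I'; first by lia.
have [|A L] := bi_alive I' (i := h.+1); first by rewrite H2.
have := M _ L A; move=> H4 H5 H6.
have : h.+1 * D.+1 <= cap * D.+1 by rewrite leq_mul2r (leq_trans H2 H1) orbT.
by rewrite /= in H6 *; nia.
Qed.

Hypothesis Hh : 0 < head.

Let x := q head.

Lemma bi_x : alive x /\ x < n.
Proof. by apply: (bi_alive I); rewrite Hh (bi_head I). Qed.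

Hypothesis Hk : k < size (N x).

Let y := nth 0 (N x) k.

Lemma y_in : y \in N x. Proof. exact: mem_nth. Qed.

Lemma y_notin : y \notin take k (N x).
Proof.
have := ng_uniq G x; rewrite -{1}(cat_take_drop k (N x)) (drop_nth 0) // cat_uniq /=.
by case/and3P=> _; rewrite negb_or => /andP[].
Qed.

Lemma take_k1 : take k.+1 (N x) =i y :: take k (N x).
Proof. by move=> z; rewrite (take_nth 0) // mem_rcons. Qed.

Lemma bfs_inv_scanned :
  (alive y -> exists2 j, 0 < j <= tail & q j = y /\ tree_edge par head j) ->
  (if full then 0 < par head /\ y = q (par head) else True) ->
  bfs_inv head tail k.+1 c.+1 pos q par dep.
Proof.
move=> Hy Hfull; have [T P1 P2 A1 A2 A3 A4 A5 A6 A7 A8 A9] := I.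
split=> //.
- move=> _ z; rewrite take_k1 inE => /orP[/eqP->|Hz]; [exact: Hy | exact: A5].
- by move: Hk Hh; rewrite /x; case: (head).
- move=> j /A7[|[? Hj]]; [by left | right]; split=> //.
  by rewrite take_k1 inE Hj orbT.
- move: A9; case: full Hfull => [[Hp Ey] A9|_ A9]; last by lia.
  move: A9; rewrite -/x take_k1 -Ey Hp inE eqxx (negbTE y_notin) /=; lia.
Qed.

Lemma bfs_inv_dead : ~~ alive y -> bfs_inv head tail k.+1 c.+1 pos q par dep.
Proof.
move=> Hy; apply: bfs_inv_scanned => [|]; first by rewrite (negbTE Hy).
have := mode (ng_lt G y_in).
by case: full => //; rewrite (negbTE Hy).
Qed.

Lemma bfs_inv_parent : 0 < pos y -> pos y = par head ->
  bfs_inv head tail k.+1 c.+1 pos q par dep.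
Proof.
move=> Hp Ep; have [L E] := bi_pos I Hp; apply: bfs_inv_scanned.
  by move=> _; exists (pos y); rewrite ?Hp // /tree_edge -Ep eqxx orbT.
by case: full => //; rewrite -Ep E.
Qed.

Lemma bfs_inv_new : alive y -> pos y = 0 -> tail < cap ->
  bfs_inv head tail.+1 k.+1 c.+1 (update pos y tail.+1) (update q tail.+1 y)
    (update par tail.+1 head) (update dep tail.+1 (dep head).+1).
Proof.
move=> Ay Hp Hc; have [T P1 P2 A1 A2 A3 A4 A5 A6 A7 A8 A9] := I.
have [Ax Lx] := bi_x.
have qy i : 0 < i <= tail -> q i != y.
  by move=> Hi; apply/eqP => E; have := P2 i Hi; rewrite E Hp; lia.
have U (f : nat -> nat) z i : i <= tail -> update f tail.+1 z i = f i.
  by move=> Hi; rewrite /update; case: eqP => //; lia.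
have U1 (f : nat -> nat) z : update f tail.+1 z tail.+1 = z by rewrite /update eqxx.
have S i : i <= tail.+1 -> i <= tail \/ i = tail.+1 by lia.
have Hd : dep tail <= (dep head).+1 by move: A8; case: (head) Hh.
have Et : edge N alive x y by rewrite /edge y_in Ax Ay.
split.
- split=> //.
  + by rewrite U ?(bt_q1 T) ?(bt_tail T).
  + by rewrite U ?(bt_par1 T) ?(bt_tail T).
  + by rewrite U ?(bt_dep1 T) ?(bt_tail T).
  + move=> i j /andP[Hi /S[Hi'|->]] /andP[Hj /S[Hj'|->]]; rewrite ?U1 ?U //.
    * by apply: (bt_inj T); lia.
    * by move=> E; have := qy i; rewrite E eqxx; lia.
    * by move=> E; have := qy j; rewrite E eqxx; lia.
  + move=> i /andP[Hi /S[Hi'|->]]; rewrite ?U1 ?U //; last by lia.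
    by apply: (bt_par T); rewrite Hi.
  + move=> i /andP[Hi /S[Hi'|->]]; last by rewrite !U1 (U q _ _ A3).
    have Hi2 : 1 < i <= tail by rewrite Hi.
    have Hpar : par i <= tail by have := bt_par T Hi2; lia.
    by rewrite (U par _ i) // (U q _ i) // (U q _ (par i)) //; apply: (bt_edge T).
  + move=> i /andP[Hi /S[Hi'|->]]; last by rewrite !U1 (U dep _ _ A3).
    have Hi2 : 1 < i <= tail by rewrite Hi.
    have Hpar : par i <= tail by have := bt_par T Hi2; lia.
    by rewrite (U par _ i) // (U dep _ i) // (U dep _ (par i)) //; apply: (bt_dep T).
  + move=> i j /andP[Hi Hij] /S[Hj|Ej].
      by rewrite !U //; [apply: (bt_mono T); rewrite ?Hi | lia].
    subst j; rewrite U1; have /S[Hi2|->] := Hij; last by rewrite U1.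
    rewrite U //; apply: leq_trans Hd; apply: (bt_mono T) => //; by rewrite Hi.
- move=> z; rewrite {1 2}/update; case: eqP => [->|Hne]; first by rewrite /update !eqxx.
  rewrite [update pos y _ z]/update; case: (z =P y) Hne => // _ _ /P1[L E].
  by rewrite U // leqW.
- move=> i /andP[Hi /S[Hi'|->]]; last by rewrite U1 /update eqxx.
  rewrite U // /update; have /negbTE-> := qy i (introT andP (conj Hi Hi')).
  by apply: P2; rewrite Hi.
- move=> i /andP[Hi /S[Hi'|->]]; last by rewrite U1; split=> //; exact: (ng_lt G y_in).
  by rewrite U //; apply: A1; rewrite Hi.
- by [].
- exact: leqW.
- move=> i Hi z; rewrite U; last by lia.
  move=> /(A4 i Hi)[j Hj [Hq Ht]]; exists j; first by lia.
  by rewrite /tree_edge !U //; lia.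
- move=> _ z; rewrite U // -/x take_k1 inE => /orP[/eqP-> _|Hz Az].
    by exists tail.+1; rewrite ?leqnn // U1 /tree_edge U1 eqxx.
  have [j Hj [Hq Ht]] := A5 Hh z Hz Az; exists j; first by lia.
  by rewrite /tree_edge !U //; lia.
- by rewrite U //; move: Hk Hh; rewrite /x; case: (head).
- move=> j /andP[Hj /S[Hj'|->]]; rewrite ?U1 ?(U _ _ _ A3) ?U //.
    have [|H|[H1 H2]] := A7 j; [by rewrite Hj | by left |].
    by right; rewrite -/x take_k1 inE H2 orbT.
  by right; rewrite -/x take_k1 inE eqxx.
- by case: (head) Hh A3 => // h _ A3; rewrite U1 U.
- move: A9; case: full => A9; last by lia.
  have Hph : par head <= tail.
    have [E1|E1] := eqVneq head 1; first by rewrite E1 (bt_par1 T).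
    by have := bt_par T (i := head); lia.
  rewrite !(U _ _ _ A3) !U // -/x take_k1 inE.
  by apply: leq_ltn_trans A9 _; rewrite -/x; case: (0 < par head); case: (_ == y);
     case: (_ \in _); rewrite /=; lia.
Qed.

Lemma bfs_inv_found : alive y -> 0 < pos y -> pos y <> par head ->
  [/\ 0 < pos y <= tail, head != pos y, par head != pos y & par (pos y) != head] /\
  (edge N alive (q (pos y)) (q head)).
Proof.
move=> Ay Hp Hne; have [T P1 P2 A1 A2 A3 A4 A5 A6 A7 A8 A9] := I.
have [L E] := P1 _ Hp; have [Ax Lx] := bi_x.
split; last by rewrite E /edge Ay Ax (ng_sym G) ?y_in.
split.
- by rewrite Hp.
- by apply: contraNneq (ng_irr G y) => E1; rewrite -{2}E -E1; exact: y_in.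
- by rewrite eq_sym; apply/eqP.
- apply/eqP => E1.
  have H1 : 1 < pos y <= tail.
    by rewrite L; case: (pos y) Hp E1 => [//|[|//]]; rewrite (bt_par1 T); lia.
  have [|[_]] := A7 _ H1; first by rewrite E1 ltnn.
  by rewrite E; apply/negP; exact: y_notin.
Qed.

End Step.

Lemma bfs_inv_advance head tail k c pos q par dep :
  bfs_inv head tail k c pos q par dep ->
  k = (if head is 0 then 0 else size (N (q head))) -> head < tail ->
  bfs_inv head.+1 tail 0 c pos q par dep /\
  forall i, 0 < i <= head -> processed (edge N alive) tail q par i.
Proof.
move=> I Ek Hlt; have [T P1 P2 A1 A2 A3 A4 A5 A6 A7 A8 A9] := I.
have PR i : 0 < i <= head -> processed (edge N alive) tail q par i.
  move=> Hi; case: (ltnP i head) => Hih; first by apply: A4; lia.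
  have Eh : i = head by lia.
  subst i; have Hh : 0 < head by lia.
  move=> y /and3P[Hy _ Ay]; apply: A5 => //.
  by rewrite Ek; case: (head) Hh Hy => // h _; rewrite take_size.
split=> //; split=> //.
- by move=> _ y; rewrite take0.
- by move=> j /A7[H|[H _]]; left; [exact: ltnW | rewrite H].
- case: head A8 {I Ek A3 A4 A5 A6 A7 A9 PR} Hlt => [-> _|h A8 Hlt].
    by rewrite (bt_dep1 T).
  by apply: leq_trans A8 _; rewrite ltnS; apply: (bt_mono T); lia.
- move: A9; case: full mode => M A9.
    by apply: leq_trans A9 _; case: (_ && _); lia.
  rewrite addn0 /=; case: head Ek A9 Hlt {I A3 A4 A5 A6 A7 A8 PR} => [->|h Ek A9 Hlt] //.
  apply: leq_trans A9 _; rewrite /= mulSn addnC leq_add2r Ek.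
  by have [|Aq Lq] := A1 h.+1; [lia | apply: M].
Qed.

Lemma bfs_exhausted head tail k c pos q par dep :
  bfs_inv head tail k c pos q par dep ->
  k = (if head is 0 then 0 else size (N (q head))) -> tail <= head ->
  forall i, 0 < i <= tail -> processed (edge N alive) tail q par i.
Proof.
move=> I Ek Hle; have [T P1 P2 A1 A2 A3 A4 A5 A6 A7 A8 A9] := I.
move=> i Hi; case: (ltnP i head) => Hih; first by apply: A4; lia.
have Eh : i = head by lia.
subst i; have Hh : 0 < head by lia.
move=> y /and3P[Hy _ Ay]; apply: A5 => //.
by rewrite Ek; case: (head) Hh Hy => // h _; rewrite take_size.
Qed.

End BfsInvariant.

(** * The search procedure *)

Local Arguments update f i x j /.

Local Notation rOut := 0. Local Notation rN := 1. Local Notation rZero := 2. Local Notation rOne := 3.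
Local Notation rV := 4. Local Notation rThr := 5. Local Notation rCap := 6. Local Notation rHead := 7.
Local Notation rTail := 8. Local Notation rPtr := 9. Local Notation rEnd := 10. Local Notation rY := 11.
Local Notation rM := 12. Local Notation rP := 13. Local Notation rGo := 14. Local Notation rF := 15.
Local Notation rT := 16. Local Notation rRho := 17. Local Notation rBest := 18. Local Notation rI := 19.
Local Notation rJ := 20. Local Notation rLen := 21.

Local Notation aPos := 0. Local Notation aDead := 1. Local Notation aQ := 2. Local Notation aPar := 3.
Local Notation aDep := 4.

Definition skip := Blk [::].
Definition setc d k := Blk [:: BConst d k].

Definition bfs_init := Blk
  [:: BAdd rTail rOne rZero; BSet aQ rTail rV; BSet aPar rTail rZero;
      BSet aDep rTail rZero; BSet aPos rV rTail; BConst rHead 0; BConst rPtr 0;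
      BConst rEnd 0; BConst rF 0; BConst rGo 1].

Definition bfs_enqueue := Blk
  [:: BAdd rTail rTail rOne; BSet aQ rTail rY; BSet aPar rTail rHead;
      BGet rT aDep rHead; BAdd rT rT rOne; BSet aDep rTail rT; BSet aPos rY rTail].

Definition bfs_found := Blk [:: BAdd rF rM rZero; BConst rGo 0].

(* A vertex is live if its cell in [aDead] is below [rThr].  Deletions in the round
   of radius [r] write [r], so that nothing has to be reset between rounds; [n + 1]
   marks the vertices of high degree for good, and with [rThr = n + 2] the search
   sees the whole graph. *)
Definition bfs_scan :=
  Seq (Blk [:: BInp rY rPtr; BAdd rPtr rPtr rOne; BGet rT aDead rY])
  (If rT rThr
    (Seq (Blk [:: BGet rM aPos rY])
    (If rZero rM
      (Seq (Blk [:: BGet rP aPar rHead])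
      (If rM rP bfs_found (If rP rM bfs_found skip)))
      (If rTail rCap bfs_enqueue (setc rGo 0))))
    skip).

Definition bfs_advance :=
  If rHead rTail
    (Blk [:: BAdd rHead rHead rOne; BGet rT aQ rHead; BAdd rT rT rOne; BInp rPtr rT;
             BAdd rT rT rOne; BInp rEnd rT])
    (setc rGo 0).

Definition bfs := Seq bfs_init (While rZero rGo (If rPtr rEnd bfs_scan bfs_advance)).

Record input_graph (n base : nat) (inp : nat -> nat) (N : nat -> seq nat) : Prop := InputGraph {
  ig_graph : nat_graph n N;
  ig_n : inp 0 = n;
  ig_off : forall x, x < n -> inp x.+2 = inp x.+1 + size (N x);
  ig_list : forall x k, x < n -> k < size (N x) -> inp (inp x.+1 + k) = nth 0 (N x) k;
  ig_base : forall x, x < n -> inp x.+1 + size (N x) <= base;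
  ig_nbase : n + 2 <= base }.

Record bfs_res n N alive v cap D full (head tail fj : nat) (pos q par dep : nat -> nat) : Prop := BfsRes {
  br_inv : exists k c, bfs_inv n N alive v cap D full head tail k c pos q par dep;
  br_head : 0 < head;
  br_found : 0 < fj ->
    [/\ 0 < fj <= tail, head != fj, par head != fj & par fj != head] /\
    edge N alive (q fj) (q head);
  br_nfound : fj = 0 -> tail = cap \/
    forall i, 0 < i <= tail -> processed (edge N alive) tail q par i }.

Section BfsSpec.
Variables (W base n : nat) (inp : nat -> nat) (N : nat -> seq nat).
Hypothesis IG : input_graph n base inp N.
Hypothesis HW : 100 * base <= W.
Let G := ig_graph IG.

Definition bfs_time (D cap : nat) (full : bool) : nat :=
  60 * ((if full then 3 * n else cap * D.+1) + 5).

Lemma bfs_spec s v thr cap D (full : bool) (Q : hst -> Prop) :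
  let alive x := ar s aDead x < thr in
  rg s rZero = 0 -> rg s rOne = 1 -> rg s rV = v -> rg s rThr = thr -> rg s rCap = cap ->
  v < n -> alive v -> 0 < cap -> (forall x, ar s aPos x = 0) ->
  (forall x, x < n -> if full then is_true (alive x) else (alive x -> size (N x) <= D)) ->
  (forall s', bfs_res n N alive v cap D full (rg s' rHead) (rg s' rTail) (rg s' rF)
      (ar s' aPos) (ar s' aQ) (ar s' aPar) (ar s' aDep) ->
    clk s' <= clk s + bfs_time D cap full -> Q s') ->
  wp W base inp bfs s Q.
Proof.
case: s => r0 a0 t0 /= E2 E3 E4 E5 E6 Hv Av Hcap Hpos mode HQ.
have Hnb := ig_nbase IG; set dead := a0 1 in Av mode HQ *.
pose alive x := dead x < thr; rewrite -/alive in Av mode HQ.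
pose Inv s' := [/\ rg s' rZero = 0, rg s' rOne = 1, rg s' rThr = thr, rg s' rCap = cap &
    ar s' aDead = dead] /\
  exists k c, bfs_inv n N alive v cap D full (rg s' rHead) (rg s' rTail) k c
      (ar s' aPos) (ar s' aQ) (ar s' aPar) (ar s' aDep) /\
    clk s' + 60 * rg s' rGo <= t0 + 60 * (c + rg s' rHead + 2) /\
    ((rg s' rGo = 1 /\ rg s' rF = 0 /\
      (rg s' rHead = 0 -> rg s' rPtr = rg s' rEnd /\ k = 0) /\
      (0 < rg s' rHead -> rg s' rPtr = inp (ar s' aQ (rg s' rHead)).+1 + k /\
        rg s' rEnd = inp (ar s' aQ (rg s' rHead)).+1 + size (N (ar s' aQ (rg s' rHead))))) \/
     (rg s' rGo = 0 /\ bfs_res n N alive v cap D full (rg s' rHead) (rg s' rTail) (rg s' rF)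
      (ar s' aPos) (ar s' aQ) (ar s' aPar) (ar s' aDep))).
have Hres s' : Inv s' -> ~~ (0 < rg s' rGo) -> bfs_res n N alive v cap D full (rg s' rHead)
    (rg s' rTail) (rg s' rF) (ar s' aPos) (ar s' aQ) (ar s' aPar) (ar s' aDep).
  by case=> _ [k [c [_ [_ [[-> _]|[_ //]]]]]].
apply: wp_seq; apply: wp_blk; first by rewrite /= E2 E3 E4; lia.
apply: (@wp_while _ _ _ Inv (t0 + bfs_time D cap full)).
- split=> //; exists 0, 0; rewrite /= E2 E3 E4; split; last first.
    by split; [lia | left].
  exact: bfs_inv_init.
- move=> s' [_ [k [c [I [Ht _]]]]]; have := bi_iterations mode I; rewrite /bfs_time; lia.
- move=> [r a t] [/= [R2 R3 R5 R6 Ad] [k [c [I [Ht H]]]]] Hgo.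
  rewrite R2 in Hgo; case: H => [[Rgo [RF [Hptr0 Hptr]]]|[Rgo _]]; last by rewrite Rgo in Hgo.
  rewrite Rgo in Ht.
  have Htn := bi_tail_le I; have Hht := bi_head I.
  apply: wp_if => /= Hpe.
    have Hh : 0 < r 7 by case: posnP => // /Hptr0[E _]; rewrite E ltnn in Hpe.
    have [Rp Re] := Hptr Hh.
    set x := a 2 (r 7) in Rp Re.
    have [Ax Lx] := bi_x I Hh; rewrite -/x in Ax Lx.
    have Hk : k < size (N x) by lia.
    have Hy := mem_nth 0 Hk; set y := nth 0 (N x) k in Hy.
    have Ly : y < n := ng_lt G Hy.
    have Ey : inp (r 9) = y by rewrite Rp (ig_list IG).
    have Hb := ig_base IG Lx.
    apply: wp_seq; apply: wp_blk; first by rewrite /= Ey R3; lia.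
    rewrite /= Ey R3 Ad.
    apply: wp_if => /= Hdead; rewrite R5 in Hdead; last first.
      apply: wp_blk => //=; split=> //; exists k.+1, c.+1; rewrite /= Rgo; split; last first.
        split; first lia.
        by left; do 2!split=> //; split=> [|_]; rewrite -?/x; lia.
      by apply: bfs_inv_dead => //; rewrite -leqNgt.
    apply: wp_seq; apply: wp_blk; first by rewrite /=; lia.
    rewrite /=; apply: wp_if => /=; rewrite R2 => Hvis; last first.
      apply: wp_if => /=; rewrite R6 => Hc.
        have Hdep : a 4 (r 7) <= n by have := bt_dep_lt (bi_tree I) (i := r 7); lia.
        apply: wp_blk; first by rewrite /= R3; lia.
        split=> //; exists k.+1, c.+1; rewrite /= R3 Rgo !addn1; split; last first.
          split; first lia.
          left; do 2!split=> //; split=> [|_]; first lia.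
          by case: eqP => [|_]; rewrite -?/x; lia.
        by apply: bfs_inv_new => //; apply/eqP; rewrite -leqn0.
      rewrite /setc; apply: wp_blk => /=; first lia.
      split=> //; exists k, c; rewrite /=; split=> //.
      split; first lia.
      right; split=> //; split=> //; first by exists k, c.
        by rewrite RF.
      by move=> _; left; have := bi_cap I; lia.
    have Ht2 : r 7 <= n by lia.
    apply: wp_seq; apply: wp_blk; first by rewrite /=; lia.
    have Hfin s'' : a 0 y <> a 3 (r 7) -> rg s'' 2 = 0 -> rg s'' 3 = 1 -> rg s'' 5 = thr ->
        rg s'' 6 = cap -> ar s'' = a -> rg s'' 7 = r 7 -> rg s'' 8 = r 8 ->
        rg s'' 15 = a 0 y -> rg s'' 14 = 0 -> clk s'' <= t0 + 60 * (c + r 7 + 2) -> Inv s''.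
      move=> Hne S2 S3 S5 S6 Sa S7 S8 S15 S14 Sc; rewrite /Inv Sa S2 S3 S5 S6 S7 S8 S15 S14.
      split=> //; exists k, c; split=> //; split; first lia.
      right; split=> //; split=> //; first by exists k, c.
        by move=> Hv'; exact: (bfs_inv_found G I Hh Hk Hdead Hv' Hne).
      by move=> E; rewrite E in Hvis.
    have [Hpy _] := bi_pos I Hvis.
    rewrite /=; apply: wp_if => /= Hmp.
      apply: wp_blk; first by rewrite /= R2; lia.
      apply: Hfin => //=; rewrite ?R2 ?addn0 //; lia.
    apply: wp_if => /= Hpm.
      apply: wp_blk; first by rewrite /= R2; lia.
      apply: Hfin => //=; rewrite ?R2 ?addn0 //; lia.
    apply: wp_blk => //=; split=> //; exists k.+1, c.+1; rewrite /= Rgo; split; last first.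
      split; first lia.
      by left; do 2!split=> //; split=> [|_]; rewrite -?/x; lia.
    by apply: bfs_inv_parent => //; rewrite -/x -/y; lia.
  have Ek : k = (if r 7 is 0 then 0 else size (N (a 2 (r 7)))).
    have := bi_k I; case: (posnP (r 7)) => [E0|Hh]; first by have [_ ->] := Hptr0 E0; rewrite E0.
    have := Hptr Hh; case: (r 7) Hh Hpe => // h _; lia.
  apply: wp_if => /= Hht2.
    have [I' _] := bfs_inv_advance mode I Ek Hht2.
    have [Aq Lq] := bi_alive I' (i := (r 7).+1) ltac:(lia).
    have Hb := ig_base IG Lq; have Ho := ig_off IG Lq.
    apply: wp_blk; first by rewrite /= R3 !addn1 /=; lia.
    rewrite /=; split=> //; exists 0, c; rewrite /= R3 Rgo !addn1; split=> //.
    split; first lia.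
    by left; do 2!split=> //; split=> [//|_]; rewrite addn0 Ho.
  rewrite /setc; apply: wp_blk => /=; first lia.
  split=> //; exists k, c; rewrite /=; split=> //.
  split; first lia.
  right; split=> //; split=> //; first by exists k, c.
  - by have := bt_tail (bi_tree I); lia.
  - by rewrite RF.
  - by move=> _; right; apply: bfs_exhausted I Ek Hht2.
- move=> s' [[R2 R3 R5 R6 Ad] [k [c [I [Ht H]]]]] Hgo; apply: HQ => /=.
    by case: H => [[H _]|[_ //]]; move: Hgo; rewrite R2 H.
  have := bi_iterations mode I; rewrite /bfs_time; lia.
Qed.
End BfsSpec.

Definition climb_loop := While rZero rGo
  (If rI rJ (Blk [:: BGet rJ aPar rJ; BAdd rLen rLen rOne])
    (If rJ rI (Blk [:: BGet rI aPar rI; BAdd rLen rLen rOne])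
      (setc rGo 0))).

Definition report :=
  If rZero rF
    (Seq (Blk [:: BAdd rI rHead rZero; BAdd rJ rF rZero; BConst rLen 1; BConst rGo 1])
    (Seq climb_loop
      (If rLen rBest (Blk [:: BAdd rBest rLen rZero]) skip)))
    skip.

Definition search := Seq bfs report.

Definition for_queue (l : seq binstr) :=
  Seq (Blk [:: BConst rI 1; BAdd rT rTail rOne])
  (While rI rT (Blk (BGet rY aQ rI :: l ++ [:: BAdd rI rI rOne]))).

Definition clean := for_queue [:: BSet aPos rY rZero].
Definition kill := for_queue [:: BSet aDead rY rRho].

Definition has_ncycle (N : nat -> seq nat) (k : nat) : Prop :=
  exists c : seq nat, [/\ size c = k, 2 < k & ucycle (edge N xpredT) c].

Lemma bfs_res_dep n N alive v cap D full head tail fj pos q par dep i :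
  bfs_res n N alive v cap D full head tail fj pos q par dep ->
  0 < i <= tail -> dep i <= (dep head).+1.
Proof.
case=> [[k [c I]]] Hh _ _ Hi; apply: leq_trans (bt_mono (bi_tree I) (i := i) (j := tail) _ _) _ => //.
by have := bi_dep I; case: (head) Hh.
Qed.

Section SearchSpec.
Variables (W base n : nat) (inp : nat -> nat) (N : nat -> seq nat).
Hypothesis IG : input_graph n base inp N.
Hypothesis HW : 100 * base <= W.
Let G := ig_graph IG.

Lemma report_spec s alive v cap D full (Q : hst -> Prop) :
  rg s rZero = 0 -> rg s rOne = 1 ->
  bfs_res n N alive v cap D full (rg s rHead) (rg s rTail) (rg s rF)
      (ar s aPos) (ar s aQ) (ar s aPar) (ar s aDep) ->
  (forall s', rg s' rBest <= rg s rBest ->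
    rg s' rBest = rg s rBest \/ has_ncycle N (rg s' rBest) ->
    (0 < rg s rF -> rg s' rBest <= (ar s aDep (rg s rHead)).*2.+2) ->
    clk s' <= clk s + 40 * (2 * rg s rTail + 5) -> Q s') ->
  wp W base inp report s Q.
Proof.
case: s => r a t /= R2 R3 BR HQ.
have Hnb := ig_nbase IG.
have [[k [c I]] Hh Hf _] := BR; have T := bi_tree I.
have Htn := bi_tail_le I; have Hht := bi_head I.
have Hpar i : 1 < i <= r 8 -> 0 < a 3 i < i := bt_par T (i := i).
have Hdep i : 1 < i <= r 8 -> a 4 i = (a 4 (a 3 i)).+1 := bt_dep T (i := i).
apply: wp_if => /=; rewrite R2 => HF; last first.
  by apply: wp_blk => //=; apply: HQ => //=; [left | lia..].
have [[Hfr Ehf P1 P2] Ee] := Hf HF.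
pose B := (a 4 (r 7) + a 4 (r 15)).
have HB : B <= 2 * r 8 /\ B <= (a 4 (r 7)).*2.+1.
  have := bt_dep_lt T (i := r 7); have := bt_dep_lt T (i := r 15).
  by have := bfs_res_dep BR Hfr; rewrite /B; lia.
pose Inv s := [/\ rg s 2 = 0, rg s 3 = 1, ar s = a & rg s 18 = r 18] /\
  ([/\ climb (a 3) (r 7) (r 15) (rg s 19) (rg s 20) (rg s 21),
   0 < rg s 19 <= r 8, 0 < rg s 20 <= r 8,
   rg s 21 + a 4 (rg s 19) + a 4 (rg s 20) = B.+1
 & clk s + 20 * rg s 14 <= t + 20 * (rg s 21 + 2)] /\ (rg s 14 = 1 \/ (rg s 14 = 0 /\ rg s 19 = rg s 20))).
apply: wp_seq; apply: wp_blk; first by rewrite /= R2; lia.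
apply: wp_seq; apply: (@wp_while _ _ _ Inv (t + 20 * (B + 3))).
- split=> //=; rewrite R2 !addn0; split; last by left.
  by split=> //; [exact: climb0 | lia..].
- by move=> s [_ [[_ _ _ H1 H2] _]]; lia.
- move=> [r' a' t'] [/= [S2 S3 -> S18] [[C Hi Hj HL Hc] Hg]] Hgo; rewrite S2 in Hgo.
  have {}Hg : r' 14 = 1 by lia.
  apply: wp_if => /= Hij.
    have Pj := Hpar (r' 20) ltac:(lia); have Dj := Hdep (r' 20) ltac:(lia).
    apply: wp_blk => /=; first by rewrite S3; lia.
    split=> //=; rewrite S3 addn1; split; last by left.
    by split=> //; [apply: climb_right => //| | |]; lia.
  apply: wp_if => /= Hji.
    have Pj := Hpar (r' 19) ltac:(lia); have Dj := Hdep (r' 19) ltac:(lia).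
    apply: wp_blk => /=; first by rewrite S3; lia.
    split=> //=; rewrite S3 addn1; split; last by left.
    by split=> //; [apply: climb_left => //| | |]; lia.
  rewrite /setc; apply: wp_blk => /=; first lia.
  by split=> //=; split; [split=> // | right; split=> //]; lia.
- move=> [r' a' t'] [/= [S2 S3 -> S18] [[C Hi Hj HL Hc] Hg]] Hgo; rewrite S2 in Hgo.
  have E : r' 20 = r' 19 by lia.
  rewrite E in C; have Cy := climb_cycle (edge_sym alive G) T (h := r 7) (f := r 15) _ Hfr _ Ehf P1 P2 Ee C.
  have {}Cy : has_ncycle N (r' 21).
    have [||cy [Sc Hl Uc]] := Cy; [by rewrite Hh | lia |].
    exists cy; split=> //; move: Uc; rewrite /ucycle => /andP[Hcy ->]; rewrite andbT.
    by apply: sub_cycle Hcy => x y /and3P[Hxy _ _]; rewrite /edge Hxy.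
  apply: wp_if => /=; rewrite S18 => Hlt.
    apply: wp_blk => /=; first by rewrite S2; lia.
    by apply: HQ => /=; rewrite ?S2 ?addn0; [lia | right | lia | lia].
  by apply: wp_blk => //=; apply: HQ => /=; [lia | left | lia | lia].
Qed.

Definition search_time (D cap : nat) (full : bool) : nat :=
  bfs_time n D cap full + 40 * (2 * minn n cap + 5).

Record search_res (alive : pred nat) v cap (best best' tail : nat) (pos q dep : nat -> nat) : Prop :=
  SearchRes {
  sr_best : best' <= best;
  sr_cycle : best' = best \/ has_ncycle N best';
  sr_root : q 1 = v;
  sr_tail : 0 < tail <= minn n cap;
  sr_pos : forall x, 0 < pos x -> exists2 i, 0 < i <= tail & q i = x;
  sr_alive : forall i, 0 < i <= tail -> alive (q i) /\ q i < n;
  sr_inj : forall i j, 0 < i <= tail -> 0 < j <= tail -> q i = q j -> i = j;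
  sr_size : forall K m, small (edge N alive) K v m -> dep tail <= K -> tail <= m;
  sr_within : forall i, 0 < i <= tail -> within (edge N alive) (dep tail) v (q i);
  sr_near_cycle : forall (c : seq nat) d u, ucycle (edge N alive) c -> 2 < size c ->
    u \in c -> within (edge N alive) d v u ->
    best' <= size c + d.*2 + odd (size c) \/
    (tail = cap /\ dep tail <= d + uphalf (size c));
  sr_ball : forall r, [\/ best' <= r.*2, tail = cap /\ dep tail <= r |
    small (edge N alive) r v cap] }.

Lemma search_spec s v thr cap D (full : bool) (Q : hst -> Prop) :
  let alive x := ar s aDead x < thr in
  rg s rZero = 0 -> rg s rOne = 1 -> rg s rV = v -> rg s rThr = thr -> rg s rCap = cap ->
  v < n -> alive v -> 0 < cap -> (forall x, ar s aPos x = 0) ->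
  (forall x, x < n -> if full then is_true (alive x) else (alive x -> size (N x) <= D)) ->
  (forall s', search_res alive v cap (rg s rBest) (rg s' rBest) (rg s' rTail)
      (ar s' aPos) (ar s' aQ) (ar s' aDep) ->
    clk s' <= clk s + search_time D cap full -> Q s') ->
  wp W base inp search s Q.
Proof.
move=> alive R2 R3 R4 R5 R6 Hv Av Hcap Hpos mode HQ.
apply: wp_seq; apply: wp_frame.
apply: (bfs_spec IG HW (full := full) (D := D) R2 R3 R4 R5 R6) => // s1 BR Hclk1 F1 F2.
apply: wp_frame; apply: (report_spec _ _ BR); try by rewrite F1.
move=> s' Hb Hc Hf Hclk2 F1' F2'.
have [[k [c I]] Hh _ Hnf] := BR; have T := bi_tree I.
have Et : rg s' 8 = rg s1 8 by rewrite F1'.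
have Htn := bi_tail_le I; have Hht := bi_head I; have Hcp := bi_cap I.
have Hdt : ar s1 4 (rg s1 8) <= (ar s1 4 (rg s1 7)).+1.
  by apply: bfs_res_dep BR _; rewrite (bt_tail T) leqnn.
have Hlow K : K <= ar s1 4 (rg s1 7) ->
    forall i, 0 < i <= rg s1 8 -> ar s1 4 i < K -> processed (edge N alive) (rg s1 8) (ar s1 2) (ar s1 3) i.
  move=> HK i Hi Hd; apply: (bi_proc I); case/andP: Hi => -> Hi /=.
  by rewrite ltnNge; apply: contraL Hd => Hle; rewrite -leqNgt (leq_trans HK) // (bt_mono T) // Hh.
apply: HQ; last by move: Hclk1 Hclk2; rewrite /search_time; lia.
rewrite Et !F2' //; rewrite (F1 rBest) // in Hb Hc; split=> //.
- exact: (bt_q1 T).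
- by rewrite (bt_tail T); lia.
- by move=> x Hx; have [H1 H2] := bi_pos I Hx; exists (ar s1 0 x) => //; rewrite Hx.
- exact: (bi_alive I).
- exact: (bt_inj T).
- move=> K m Hs HK; apply: (size_queue T Hs) => i Hi; apply: leq_trans HK.
  by apply: (bt_mono T) => //; lia.
- by move=> i Hi; apply: within_leq (bt_within T Hi); apply: (bt_mono T); lia.
- move=> cy d u Hcy Sc Hu Hd; set K := d + (size cy).-1./2.
  have HP : ~ (forall i, 0 < i <= rg s1 8 -> ar s1 4 i <= K ->
      processed (edge N alive) (rg s1 8) (ar s1 2) (ar s1 3) i).
    exact: (processed_acyclic T (edge_sym alive G) Hcy Sc Hu Hd).
  have HdK : ar s1 4 (rg s1 7) <= K.
    by rewrite leqNgt; apply/negP => /Hlow H; apply: HP => i Hi Hi2; apply: H.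
  have [F0|Fp] := posnP (rg s1 15).
    have [E|Hall] := Hnf F0; last by case: HP => i Hi _; apply: Hall.
    by right; split=> //; rewrite /K in HdK; lia.
  by left; have := Hf Fp; rewrite /K in HdK; lia.
- move=> r; have [Hlt|Hge] := ltnP (ar s1 4 (rg s1 7)) r; last first.
    apply: Or33; have [sq Hsq Hin] := small_queue T (Hlow r Hge).
    by exists sq => //; apply: leq_trans Hcp.
  have [F0|Fp] := posnP (rg s1 15); last by apply: Or31; have := Hf Fp; lia.
  have [E|Hall] := Hnf F0; first by apply: Or32; split=> //; lia.
  apply: Or33; have [|sq Hsq Hin] := small_queue T (K := r); first by move=> i Hi _; apply: Hall.
  by exists sq => //; apply: leq_trans Hcp.
Qed.

Lemma for_queue_spec k x s (Q : hst -> Prop) : k < 8 ->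
  x != rI -> x != rT -> x != rY -> k != aQ ->
  rg s rOne = 1 -> rg s rTail <= n -> (forall i, 0 < i <= rg s rTail -> ar s aQ i < n) ->
  (forall s', (forall y, ar s' k y = rg s x /\ (exists2 i, 0 < i <= rg s rTail & ar s aQ i = y) \/
      ar s' k y = ar s k y /\ forall i, 0 < i <= rg s rTail -> ar s aQ i <> y) ->
    clk s' <= clk s + 20 * (rg s rTail + 1) -> Q s') ->
  wp W base inp (for_queue [:: BSet k rY x]) s Q.
Proof.
have Hnb := ig_nbase IG.
case: s => r a t /= Hk X1 X2 X3 Hk2 R3 Ht Hq HQ.
pose Inv s := [/\ rg s 3 = 1, rg s 16 = r 8 + 1, rg s x = r x & ar s aQ = a aQ] /\
  [/\ 0 < rg s 19 <= r 8 + 1, clk s <= t + 2 + 16 * (rg s 19 - 1) &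
   forall y, ar s k y = r x /\ (exists2 i, 0 < i < rg s 19 & a aQ i = y) \/
     ar s k y = a k y /\ forall i, 0 < i < rg s 19 -> a aQ i <> y].
apply: wp_seq; apply: wp_blk; first by rewrite /= R3; lia.
apply: (@wp_while _ _ _ Inv (t + 2 + 16 * r 8)).
- split; rewrite /= ?R3 ?(negbTE X1) ?(negbTE X2) //; split; [lia | lia |].
  by move=> y; right; split=> // i; lia.
- by move=> s [_ [H1 H2 _]]; lia.
- move=> [r' a' t'] [/= [S3 S16 Sx Sq] [Hi Hc Ha]] Hlt.
  have Hqi : a 2 (r' 19) < n by apply: Hq; lia.
  apply: wp_blk => /=; first by rewrite S3 Sq; lia.
  split=> /=; rewrite ?(negbTE X1) ?(negbTE X3) ?S3 ?Sq.
    by rewrite eq_sym (negbTE Hk2).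
  split; [lia | lia |] => y; rewrite eqxx Sx /=.
  case: (y =P a 2 (r' 19)) => [->|Hne]; first by left; split=> //; exists (r' 19) => //; lia.
  have [[-> [i Hi2 Hy]]|[-> Hn]] := Ha y.
    by left; split=> //; exists i => //; lia.
  right; split=> // i Hi2.
  by have [->|Hii] := eqVneq i (r' 19); [exact/nesym | apply: Hn; lia].
- move=> [r' a' t'] [/= [S3 S16 Sx Sq] [Hi Hc Ha]] Hge.
  have E : r' 19 = r 8 + 1 by lia.
  apply: HQ => /=; last lia.
  move=> y; have [[-> [i Hi2 Hy]]|[-> Hn]] := Ha y.
    by left; split=> //; exists i => //; lia.
  by right; split=> // i Hi2; apply: Hn; lia.
Qed.

End SearchSpec.

(** * One round of the algorithm *)

Local Notation rInf := 22. Local Notation rInf2 := 23. Local Notation rS := 24. Local Notation rL := 25.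

Definition probe (thr cap : nat) :=
  Seq (Blk [:: BAdd rThr thr rZero; BAdd rCap cap rZero]) search.

Definition full_search := Seq (probe rInf2 rInf) clean.

Definition for_vertices (c : cmd) :=
  Seq (setc rV 0) (While rV rN (Seq c (Blk [:: BAdd rV rV rOne]))).

Definition if_alive (c : cmd) := Seq (Blk [:: BGet rT aDead rV]) (If rT rRho c skip).

Definition pass1_body := if_alive
  (Seq (probe rRho rS)
  (Seq (If rTail rCap (setc rGo 0)
         (Seq (Blk [:: BGet rP aDep rTail])
           (If rRho rP (setc rGo 0) (Seq kill (setc rGo 1)))))
  (Seq clean
    (If rZero rGo full_search skip)))).

Definition pass2_body := if_alive (Seq (probe rRho rL) clean).

Lemma edge_sub N (alive alive' : pred nat) : {subset alive <= alive'} ->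
  subrel (edge N alive) (edge N alive').
Proof. by move=> H x y /and3P[Hy Hx Hy']; apply/and3P; split=> //; exact: H. Qed.

Lemma within_sub (E E' : rel nat) k v x : subrel E E' -> within E k v x -> within E' k v x.
Proof. by move=> H [p [Hp Hl Hs]]; exists p; split=> //; apply: sub_path Hp. Qed.

Lemma small_sub (E E' : rel nat) k v m : subrel E E' -> small E' k v m -> small E k v m.
Proof. by move=> H [s Hs Hin]; exists s => // x /(within_sub H)/Hin. Qed.

Lemma edge_ucycle N (alive : pred nat) c : ucycle (edge N xpredT) c ->
  (forall x, x \in c -> alive x) -> ucycle (edge N alive) c.
Proof.
case/andP=> Hc Uc Ha; rewrite /ucycle Uc andbT.
apply: (sub_in_cycle (P := alive) (e := edge N xpredT)) Hc; last exact/allP.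
by move=> x y Hx Hy /and3P[Hxy _ _]; apply/and3P.
Qed.

Lemma cycle_lt n N c x : nat_graph n N -> ucycle (edge N xpredT) c -> x \in c -> x < n.
Proof.
by move=> G /andP[Hc _] Hx; have /and3P[/(ng_lt G)] := prev_cycle Hc Hx.
Qed.

Section Passes.
Variables (W base n : nat) (inp : nat -> nat) (N : nat -> seq nat).
Hypothesis IG : input_graph n base inp N.
Hypothesis HW : 100 * base <= W.
Let G := ig_graph IG.
Notation wp := (wp W base inp).
Notation E := (edge N xpredT).

(* The initial estimate [2n + 2] stands for infinity: 5/8 of it exceeds the length
   of any cycle. *)
Definition ok (s : hst) : Prop :=
  [/\ rg s rN = n, rg s rZero = 0, rg s rOne = 1, rg s rInf = n.+1 & rg s rInf2 = n.+2] /\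
  [/\ forall x, ar s aPos x = 0, forall x, ar s aDead x <= n.+1 &
      rg s rBest = n.+1 + n.+1 \/ has_ncycle N (rg s rBest)].

Definition probe_time (D cap : nat) (full : bool) : nat :=
  search_time n D cap full + 20 * (minn n cap + 5).

Lemma probe_spec s (thr cap v D : nat) (full : bool) (Q : hst -> Prop) :
  let alive x := ar s aDead x < rg s thr in
  thr != rThr -> cap != rThr ->
  ok s -> rg s thr <= n.+2 -> rg s cap <= base -> rg s rV = v -> v < n -> alive v -> 0 < rg s cap ->
  (forall x, x < n -> if full then is_true (alive x) else (alive x -> size (N x) <= D)) ->
  (forall s', search_res n N alive v (rg s cap) (rg s rBest) (rg s' rBest) (rg s' rTail)
      (ar s' aPos) (ar s' aQ) (ar s' aDep) -> rg s' rCap = rg s cap ->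
    clk s' <= clk s + 2 + search_time n D (rg s cap) full -> Q s') ->
  wp (probe thr cap) s Q.
Proof.
have Hnb := ig_nbase IG.
case: s => r a t /= T1 T2 [/= [R1 R2 R3 R22 R23] [Hpos Hdead Hb]] Ht Hc R4 Hv Av Hc0 mode HQ.
apply: wp_seq; apply: wp_blk => /=; first by rewrite (negbTE T2) R2; lia.
rewrite (negbTE T2) R2 !addn0; apply: wp_frame.
apply: (search_spec IG HW (v := v) (thr := r thr) (cap := r cap) (D := D) (full := full)) => //=.
move=> s' Hs Hclk F1 F2; apply: HQ => //.
- by rewrite F1.
- lia.
Qed.

Lemma clean_spec s (Q : hst -> Prop) :
  rg s rOne = 1 -> rg s rZero = 0 -> rg s rTail <= n ->
  (forall i, 0 < i <= rg s rTail -> ar s aQ i < n) ->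
  (forall x, 0 < ar s aPos x -> exists2 i, 0 < i <= rg s rTail & ar s aQ i = x) ->
  (forall s', (forall x, ar s' aPos x = 0) -> clk s' <= clk s + 20 * (rg s rTail + 1) -> Q s') ->
  wp clean s Q.
Proof.
move=> R3 R2 Ht Hq Hp HQ; apply: (for_queue_spec IG HW) => // s' Hs' Hc; apply: HQ => // x.
have [[-> _]|[-> Hn]] := Hs' x => //; apply/eqP; rewrite -leqn0 leqNgt; apply/negP => /Hp[i Hi].
exact: Hn.
Qed.

Lemma full_search_spec s v (Q : hst -> Prop) :
  ok s -> rg s rV = v -> v < n ->
  (forall s', ok s' -> ar s' aDead = ar s aDead -> rg s' rBest <= rg s rBest ->
    (forall (c : seq nat) d u, ucycle E c -> 2 < size c -> u \in c -> within E d v u ->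
      rg s' rBest <= size c + d.*2 + odd (size c)) ->
    clk s' <= clk s + probe_time 0 n.+1 true -> Q s') ->
  wp full_search s Q.
Proof.
move=> Hok R4 Hv HQ; have [[R1 R2 R3 R22 R23] [Hpos Hdead Hb]] := Hok.
have Hnb := ig_nbase IG.
have Hall x : ar s aDead x < rg s rInf2 by rewrite R23 ltnS.
apply: wp_seq; apply: wp_frame.
apply: (probe_spec (v := v) (D := 0) (full := true)) => //; rewrite ?R22 ?R23 //; first lia.
move=> s1 SR Rc Hclk F1 F2; have [B1 B2 _ B3 B4 B5 B6 _ B7 B8 _] := SR.
apply: wp_frame; apply: clean_spec; [by rewrite F1 | by rewrite F1 | lia | by move=> i /B5[] | exact: B4 |].
move=> s' Hp Hclk' F1' F2'.
have Hd : ar s' aDead = ar s aDead by rewrite F2' // F2.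
have Hbest : rg s' rBest = rg s1 rBest by rewrite F1'.
apply: HQ => //.
- split; split; rewrite ?Hd ?Hbest //; try by rewrite F1' // F1.
  by case: B2 => [->|]; [|right].
- by rewrite Hbest.
- rewrite Hbest => c d u Hc Sc Hu Hw; have [||H|[Et _]] := B8 c d u _ Sc Hu.
  + by apply: edge_ucycle Hc _ => x _; rewrite -R23; apply: Hall.
  + by apply: within_sub Hw; apply: edge_sub => x _; rewrite -R23; apply: Hall.
  + by [].
  + by rewrite Et in B3; lia.
- by rewrite /probe_time; lia.
Qed.

End Passes.

Section Passes.
Variables (W base n : nat) (inp : nat -> nat) (N : nat -> seq nat).
Hypothesis IG : input_graph n base inp N.
Hypothesis HW : 100 * base <= W.
Let G := ig_graph IG.
Notation wp := (wp W base inp).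
Notation E := (edge N xpredT).
Notation ok := (ok n N).

Lemma for_vertices_spec c s (I : nat -> hst -> Prop) B (Q : hst -> Prop) :
  I 0 (HSt (update (rg s) rV 0) (ar s) (1 + clk s)) ->
  (forall i s, I i s -> rg s rN = n /\ clk s <= B) ->
  (forall i s, I i s -> rg s rV = i -> i < n ->
    wp c (tick 1 s) (fun s' => [/\ rg s' rV = i, rg s' rOne = 1 &
      I i.+1 (HSt (update (rg s') rV i.+1) (ar s') (2 + clk s'))])) ->
  (forall s, I n s -> Q (tick 2 s)) ->
  wp (for_vertices c) s Q.
Proof.
move=> I0 HB Hstep HQ; have Hnb := ig_nbase IG.
pose Inv s := exists2 i, i <= n & rg s rV = i /\ I i s.
apply: wp_seq; rewrite /setc; apply: wp_blk => /=; first lia.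
apply: (@wp_while _ _ _ Inv B).
- by exists 0 => //; split=> //; case: s I0 {HB Hstep HQ Inv}.
- by move=> s' [i _ [_ /HB[]]].
- move=> s' [i Hi [Ri Ii]]; have [Rn _] := HB _ _ Ii; rewrite Ri Rn => Hlt.
  apply: wp_seq; apply: wp_conseq (Hstep _ _ Ii Ri Hlt) _ => -[r a t] /= [E1 E2 I1].
  apply: wp_blk; rewrite /= E1 E2; first lia.
  by exists i.+1 => //; rewrite addn1.
- move=> s' [i Hi [Ri Ii]]; have [Rn _] := HB _ _ Ii; rewrite Ri Rn => Hge.
  by apply: HQ; have -> : n = i by lia.
Qed.

Definition covers (best k : nat) (P : pred nat) : Prop :=
  forall c : seq nat, ucycle E c -> 2 < size c ->
  best <= size c + k.*2 + odd (size c) \/ forall x, x \in c -> P x.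

Lemma covers_best b b' k P : b' <= b -> covers b k P -> covers b' k P.
Proof. by move=> Hb H c Hc Sc; have [H1|H1] := H c Hc Sc; [left; apply: leq_trans H1 | right]. Qed.

Section Round.
Variables (D S rho : nat).
Hypothesis Hrho : 0 < rho <= n.
Hypothesis HS : 0 < S.
Hypothesis HSb : S ^ 4 < base.

Lemma leq_S : S <= S ^ 4.
Proof. by rewrite -{1}(expn1 S) leq_pexp2l. Qed.

Definition live (s : hst) : pred nat := fun x => ar s aDead x < rho.

Definition round_st (s : hst) : Prop :=
  [/\ ok s, [/\ rg s rRho = rho, rg s rS = S & rg s rL = S ^ 4 + 1],
    forall x, x < n -> ar s aDead x = n.+1 \/ (ar s aDead x <= rho /\ size (N x) <= D),
    covers (rg s rBest) 0 (fun x => ar s aDead x != n.+1) &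
    covers (rg s rBest) rho (live s)].

Definition small_live (s : hst) (u : nat) : Prop :=
  rg s rBest <= rho.*2 \/ (live s u -> small (edge N (live s)) rho u S).

Definition killed (s : hst) : nat := count (fun x => ar s aDead x == rho) (iota 0 n).

Definition pass1_inv (t0 b0 i : nat) (s : hst) : Prop :=
  [/\ round_st s, rg s rBest <= b0, forall u, u < i -> small_live s u &
  exists2 d, d * S <= killed s &
    clk s <= t0 + 1 + i * (probe_time n D S false + 60) +
      d * (probe_time n 0 n.+1 true + 20 * (n + 5))].

Lemma pass1_step t0 b0 i s : pass1_inv t0 b0 i s -> rg s rV = i -> i < n ->
  wp pass1_body (tick 1 s) (fun s' => [/\ rg s' rV = i, rg s' rOne = 1 &
    pass1_inv t0 b0 i.+1 (HSt (update (rg s') rV i.+1) (ar s') (2 + clk s'))]).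
Proof.
case: s => r a t [[Hok [/= Rr RS RL] HD Hc0 Hc1] Hb0 Hsm [d Hd Hclk]] /= R4 Hi.
rewrite /= in Hb0.
have Hnb := ig_nbase IG; have HSS := leq_S.
have [[/= R1 R2 R3 R22 R23] [/= Hpos Hdead Hbest]] := Hok.
apply: wp_seq; apply: wp_blk; first by rewrite /= R4; lia.
rewrite /= R4; apply: wp_if => /=; rewrite Rr => Hlive; last first.
  apply: wp_blk => //=; split=> //; split=> //=.
    move=> u; rewrite ltnS leq_eqVlt => /orP[/eqP->|/Hsm//].
    by right; rewrite /live /= ltnNge Hlive.
  by exists d => //=; move: Hclk; rewrite /= mulSn; lia.
apply: wp_seq; apply: wp_frame.
have mode x : x < n -> a 1 x < rho -> size (N x) <= D.
  by move=> /HD[->|[]//]; lia.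
apply: (probe_spec IG HW (v := i) (D := D) (full := false)); rewrite /= ?Rr ?RS //; try lia.
move=> s1 SR Rc Hclk1 F1 F2.
have [B1 B2 Brt B3 B4 B5 B6 _ B7 _ B8] := SR.
move: B1 B2 => /= B1 B2.
have Ed : ar s1 1 = a 1 by rewrite F2.
have Elive : live s1 = live (HSt r a t) by rewrite /live Ed.
pose Qf s' := [/\ rg s' rV = i, rg s' rOne = 1 &
    pass1_inv t0 b0 i.+1 (HSt (update (rg s') rV i.+1) (ar s') (2 + clk s'))].
have Hrest s2 : (forall j, j \notin [:: rGo; rP] -> rg s2 j = rg s1 j) -> ar s2 = ar s1 ->
    rg s2 rGo = 0 -> clk s2 <= clk s1 + 20 -> ~ (rg s1 rTail = S /\ ar s1 aDep (rg s1 rTail) <= rho) ->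
    wp (Seq clean (If rZero rGo full_search skip)) s2 Qf.
  move=> G1 G2 Go Gc Hn; apply: wp_seq; apply: wp_frame.
  apply: (clean_spec IG HW); rewrite ?G2 ?(G1 rOne) ?(G1 rZero) ?(G1 rTail) //;
    [by rewrite F1 | by rewrite F1 | lia | by move=> j /B5[] | ].
  move=> s3 Hp3 Hc3 H1 H2.
  have R3' j : j \notin writes (probe rRho rS) -> j \notin writes clean ->
      j \notin [:: rGo; rP] -> rg s3 j = r j.
    by move=> X1 X2 X3; rewrite H1 // G1 // F1 //=; case: eqP X1 => // ->.
  have Rb : rg s3 rBest = rg s1 rBest by rewrite H1 // G1.
  have Ed3 : ar s3 1 = a 1 by rewrite H2 // G2.
  have Eq2 : rg s3 rZero = 0 by rewrite R3'.
  have Ego : rg s3 rGo = 0 by rewrite H1.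
  apply: wp_if; rewrite Eq2 Ego // => _; apply: wp_blk => //.
  split=> //=; [by rewrite R3' | by rewrite R3' |].
  split; rewrite /small_live /killed /live /= ?Ed3 ?Rb.
  - split; rewrite /live /= ?Ed3 ?Rb ?R3' //; last 2 first.
    + exact: covers_best B1 Hc0.
    + exact: covers_best B1 Hc1.
    split; split=> //=; rewrite ?Rb ?Ed3 ?R3' //.
    by case: B2 => [->|]; [|right].
  - exact: leq_trans B1 Hb0.
  - move=> u; rewrite ltnS leq_eqVlt => /orP[/eqP->|/Hsm].
      by have [H|Hx|H] := B8 rho; [left | case: (Hn Hx) | right=> _].
      by case=> [?|?]; [left; apply: leq_trans B1 _ | right].
  - by exists d => //; move: Hclk Hclk1 Gc Hc3; rewrite /probe_time /= mulSn; lia.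
apply: wp_seq; apply: wp_if => /=; rewrite Rc => Htl.
  rewrite /setc; apply: wp_blk => /=; first lia.
  apply: Hrest => //=; first by move=> j; rewrite !inE negb_or => /andP[/negbTE->].
    lia.
  by move=> [E _]; rewrite E ltnn in Htl.
apply: wp_seq; apply: wp_blk => /=; first lia.
have Rr1 : rg s1 rRho = rho by rewrite F1.
apply: wp_if => /=; rewrite Rr1 => Hdep.
  rewrite /setc; apply: wp_blk => /=; first lia.
  apply: Hrest => //=; last 2 first.
  - lia.
  - by move=> [E]; rewrite leqNgt Hdep.
  by move=> j; rewrite !inE negb_or => /andP[/negbTE-> /negbTE->].
have Et : rg s1 rTail = S by lia.
apply: wp_seq; apply: wp_frame.
apply: (for_queue_spec IG HW) => //=; [by rewrite F1 | lia | by move=> j /B5[] |].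
move=> s2 Hs2 Hclk2 H1 H2; rewrite Rr1 Ed in Hs2.
rewrite /setc; apply: wp_blk => /=; first lia.
apply: wp_seq; apply: wp_frame.
have E2 j : j \notin writes kill -> j \notin [:: rGo; rP] -> rg s2 j = rg s1 j.
  by move=> X1; rewrite !inE negb_or => /andP[_ /negbTE X2]; rewrite H1 //= X2.
apply: (clean_spec IG HW) => /=; rewrite ?H2 ?E2 //; [by rewrite F1 | by rewrite F1 | lia | by move=> j /B5[] |].
move=> s3 Hp3 Hc3 H13 H23.
have Z3 : rg s3 rZero = 0 by rewrite H13 //= E2 // F1.
have G3 : rg s3 rGo = 1 by rewrite H13.
apply: wp_if; rewrite Z3 G3 // => _.
have R3' j : j \notin writes (probe rRho rS) -> j \notin writes clean ->
    j \notin [:: rGo; rP] -> rg s3 j = r j.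
  move=> X1 X2 X3; have := X3; rewrite inE negb_or => /andP[/negbTE X4 _].
  by rewrite H13 //= X4 E2 // F1 //=; case: eqP X1 => // ->.
have Rb : rg s3 rBest = rg s1 rBest by rewrite H13 //= E2.
have Ed3 : ar s3 1 = ar s2 1 by rewrite H23.
have Hle x : ar s2 1 x <= n.+1.
  by have [[-> _]|[-> _]] := Hs2 x; [lia | exact: Hdead].
apply: wp_frame; apply: (full_search_spec IG HW (v := i)) => //.
- split; split=> //=; rewrite ?Rb ?Ed3 ?R3' //.
  by case: B2 => [->|]; [|right].
- by rewrite /= R3'.
move=> s4 Hok4 Hd4 Hb4 Hfull Hc4 H14 H24.
have R4' j : j \notin writes (probe rRho rS) -> j \notin writes full_search ->
    j \notin [:: rGo; rP] -> rg s4 j = r j.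
  move=> X1 X2 X3; rewrite H14 //= R3' //.
  by apply: contra X2 => X2; rewrite mem_cat X2 orbT.
split; rewrite ?R4' //.
have Hb41 : rg s4 rBest <= rg s1 rBest by move: Hb4; rewrite /= Rb.
have Ed4 : ar s4 1 = ar s2 1 by rewrite Hd4.
have Hin j : 0 < j <= S -> a 1 (ar s1 2 j) < rho /\ ar s1 2 j < n by rewrite -Et => /B5.
have live_sub x : ar s2 1 x < rho -> a 1 x < rho.
  by have [[-> _]|[-> _]] := Hs2 x => //; rewrite ltnn.
have Hstep : round_st (HSt (update (rg s4) rV i.+1) (ar s4) (2 + clk s4)).
  split=> /=.
  - by case: Hok4 => [[E1 E2' E3 E4 E5] [E6 E7 E8]]; split.
  - by rewrite /= !R4'.
  - move=> x Hx; rewrite Ed4; have [[-> [j Hj Hq]]|[-> _]] := Hs2 x; last exact: HD.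
    right; split=> //; apply: mode => //; rewrite -Hq; apply: (Hin j _).1; lia.
  - apply: (covers_best (leq_trans Hb41 B1)) => c Hc Sc; have [?|H] := Hc0 c Hc Sc; [by left | right].
    move=> x /H; rewrite Ed4; have [[-> _]|[-> _]] := Hs2 x => // _; lia.
  - move=> c Hc Sc; have [Hx|H] := Hc1 c Hc Sc.
      by left; apply: leq_trans Hx; apply: leq_trans Hb41 B1.
    have [Hall|] := boolP (all (fun x => ar s2 1 x < rho) c).
      by right=> x Hx; rewrite /live /= Ed4; apply: (allP Hall).
    case/allPn=> x Hx Hnx; left.
    have [[_ [j Hj Hq]]|[Eq _]] := Hs2 x; last by move: Hnx; rewrite Eq; have := H x Hx; rewrite /live /= => ->.
    apply: (Hfull c rho x Hc Sc Hx).
    apply: within_leq Hdep _; rewrite -Hq; apply: within_sub (B7 j _); last lia.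
    exact: edge_sub.
split=> //; first exact: leq_trans (leq_trans Hb41 B1) Hb0.
  move=> u; rewrite /small_live /live /= Ed4 ltnS leq_eqVlt => /orP[/eqP->|/Hsm].
    right; have [[-> _]|[_ Hn]] := Hs2 i; first by rewrite ltnn.
    by case: (Hn 1); [rewrite Et; lia | rewrite Brt].
  case=> [Hx|Hx]; [left | right=> Hu].
    by apply: leq_trans Hx; apply: leq_trans Hb41 B1.
  by apply: small_sub (Hx (live_sub u Hu)); apply: edge_sub => x; apply: live_sub.
exists d.+1.
  rewrite mulSn /killed /= Ed4.
  rewrite addnC; apply: (leq_trans (n := size (filter (fun x => a 1 x == rho) (iota 0 n) ++ map (ar s1 2) (iota 1 S)))).
    by rewrite size_cat size_filter size_map size_iota leq_add2r.
  rewrite -size_filter; apply: uniq_leq_size.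
    rewrite cat_uniq filter_uniq ?iota_uniq //=; apply/andP; split.
      apply/hasPn => x /mapP[j]; rewrite mem_iota => Hj ->; rewrite mem_filter negb_and.
      by have [Hlt _] := Hin j ltac:(lia); rewrite (ltn_eqF Hlt).
    rewrite map_inj_in_uniq ?iota_uniq // => j j'; rewrite !mem_iota => Hj Hj'.
    by apply: B6; lia.
  move=> x; rewrite mem_cat !mem_filter => /orP[/andP[/eqP Hx Hxn]|/mapP[j]].
    rewrite Hxn andbT; have [[-> _]|[-> _]] := Hs2 x => //; exact/eqP.
  rewrite mem_iota => Hj ->; have [Hlt Hn] := Hin j ltac:(lia).
  rewrite mem_iota add0n leq0n Hn /= andbT.
  by have [[-> _]|[_ Hno]] := Hs2 (ar s1 2 j) => //; case: (Hno j); lia.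
move: Hclk Hclk1 Hclk2 Hc3 Hc4; rewrite /probe_time /= Et !mulSn; lia.
Qed.

End Round.
End Passes.

Definition round :=
  Seq (for_vertices pass1_body)
  (Seq (for_vertices pass2_body)
    (Blk [:: BAdd rRho rRho rRho])).

Definition rounds := Seq (setc rRho 1) (While rRho rInf round).

Section Passes.
Variables (W base n : nat) (inp : nat -> nat) (N : nat -> seq nat).
Hypothesis IG : input_graph n base inp N.
Hypothesis HW : 100 * base <= W.
Let G := ig_graph IG.
Notation wp := (wp W base inp).
Notation E := (edge N xpredT).
Notation ok := (ok n N).

Section Round.
Variables (D S : nat).
Hypothesis HS : 0 < S.
Hypothesis HSb : S ^ 4 < base.

Definition pass1_time := 10 + n * (probe_time n D S false + 60) +
   n %/ S * (probe_time n 0 n.+1 true + 20 * (n + 5)).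

Definition pass2_time := 10 + n * (probe_time n D (S ^ 4 + 1) false + 60).

Section FixedRadius.
Variable rho : nat.
Hypothesis Hrho : 0 < rho <= n.

Notation round_st := (round_st n N D S rho).
Notation small_live := (small_live N S rho).

Lemma pass1_spec s (Q : hst -> Prop) : round_st s ->
  (forall s', round_st s' -> rg s' rBest <= rg s rBest -> (forall u, u < n -> small_live s' u) ->
    clk s' <= clk s + pass1_time -> Q s') ->
  wp (for_vertices pass1_body) s Q.
Proof.
move=> Hs HQ.
have Hd s' d : d * S <= killed n rho s' -> d <= n %/ S.
  move=> H; rewrite leq_divRL //; apply: leq_trans H _.
  by rewrite /killed -[X in _ <= X](size_iota 0 n) count_size.
have Hclk t0 b0 i s' : i <= n -> pass1_inv n N D S rho t0 b0 i s' -> clk s' + 9 <= t0 + pass1_time.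
  move=> Hi [_ _ _ [d /Hd Hd' Hc]]; rewrite /pass1_time.
  have : i * (probe_time n D S false + 60) <= n * (probe_time n D S false + 60) by rewrite leq_mul2r Hi orbT.
  have : d * (probe_time n 0 n.+1 true + 20 * (n + 5)) <=
    n %/ S * (probe_time n 0 n.+1 true + 20 * (n + 5)) by rewrite leq_mul2r Hd' orbT.
  lia.
apply: (for_vertices_spec IG HW
  (I := fun i s' => i <= n /\ pass1_inv n N D S rho (clk s) (rg s rBest) i s') (B := clk s + pass1_time)).
- split=> //; case: s Hs {HQ Hclk} => r a t [[[/= ? ? ? ? ?] ?] [? ? ?] ? ? ?].
  split; [by split=> //; split | by [] | by [] |].
  by exists 0 => //=; lia.
- move=> i s' [Hi I]; split; last by have := Hclk _ _ _ _ Hi I; lia.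
  by have [[[[]]]] := I.
- move=> i s' [_ I] Hv Hi; apply: wp_conseq (pass1_step IG HW Hrho HS HSb I Hv Hi) _.
  by move=> s2 [].
- move=> s' [_ I]; have := Hclk _ _ _ _ (leqnn n) I; have [H1 Hb H2 _] := I => H3.
  by apply: HQ => //=; lia.
Qed.

Lemma pass2_spec s (Q : hst -> Prop) : round_st s -> (forall u, u < n -> small_live s u) ->
  (forall s', ok s' -> ar s' aDead = ar s aDead -> rg s' rBest <= rg s rBest ->
    [/\ rg s' rRho = rho, rg s' rS = S & rg s' rL = S ^ 4 + 1] ->
    (forall c : seq nat, ucycle E c -> 2 < size c <= 8 * rho ->
       rg s' rBest <= size c + rho.*2 + odd (size c)) ->
    clk s' <= clk s + pass2_time -> Q s') ->
  wp (for_vertices pass2_body) s Q.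
Proof.
move=> [Hok Hr HD Hc0 Hc1] Hsm HQ; have Hnb := ig_nbase IG.
set t0 := clk s in HQ *.
pose I i s' := [/\ ok s' /\ ar s' aDead = ar s aDead, rg s' rBest <= rg s rBest,
    [/\ rg s' rRho = rho, rg s' rS = S & rg s' rL = S ^ 4 + 1],
    (forall (c : seq nat) u, ucycle E c -> 2 < size c <= 8 * rho -> u \in c -> u < i ->
       rg s' rBest <= size c + rho.*2 + odd (size c)) &
    clk s' <= t0 + 1 + i * (probe_time n D (S ^ 4 + 1) false + 60)].
apply: (for_vertices_spec IG HW (I := fun i s' => i <= n /\ I i s') (B := t0 + pass2_time)).
- split=> //; move: Hok Hr => [[? ? ? ? ?] ?] [? ? ?].
  by split=> /=; [split=> //; split | by [] | by [] | by [] | rewrite /t0; lia].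
- move=> i s' [Hi [[[[Rn _ _ _ _] _] _] _ _ _ Hc]]; split=> //.
  have : i * (probe_time n D (S ^ 4 + 1) false + 60) <= n * (probe_time n D (S ^ 4 + 1) false + 60).
    by rewrite leq_mul2r Hi orbT.
  by rewrite /pass2_time; lia.
- move=> i [r a t] [_ [[Hok' Ed] Hb [Rr RS RL] Hcy Hclk]] /= R4 Hi; move: Ed Hb Rr RS RL Hclk => /= Ed Hb Rr RS RL Hclk.
  have [[/= R1 R2 R3 R22 R23] [/= Hpos Hdead Hbest]] := Hok'.
  apply: wp_seq; apply: wp_blk; first by rewrite /= R4; lia.
  have mode x : x < n -> a 1 x < rho -> size (N x) <= D.
    by rewrite Ed => /HD[->|[]//]; lia.
  have dead_case x c : ucycle E c -> 2 < size c -> x \in c -> rho <= a 1 x ->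
      rg s rBest <= size c + rho.*2 + odd (size c).
    move=> Hc Sc Hx Hle; have [//|/(_ x Hx)] := Hc1 c Hc Sc.
    by rewrite /live -Ed ltnNge Hle.
  rewrite /= R4; apply: wp_if => /=; rewrite Rr => Hlive; last first.
    apply: wp_blk => //=; split=> //; split=> //; split=> //=; last by rewrite mulSn; lia.
    move=> c u Hc Sc Hu; rewrite ltnS leq_eqVlt => /orP[/eqP Eu|]; last exact: Hcy.
    apply: leq_trans Hb _; apply: (dead_case u) => //; last by rewrite Eu.
    by case/andP: Sc.
  apply: wp_seq; apply: wp_frame.
  apply: (probe_spec IG HW (v := i) (D := D) (full := false)); rewrite /= ?Rr ?RL //; try lia.
  move=> s1 SR Rc Hclk1 F1 F2; have [B1 B2 Brt B3 B4 B5 B6 Bsz _ B8 _] := SR.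
  move: B1 B2 => /= B1 B2.
  apply: wp_frame.
  apply: (clean_spec IG HW); [by rewrite F1 | by rewrite F1 | lia | by move=> j /B5[] | exact: B4 |].
  move=> s3 Hp3 Hc3 H1 H2.
  have R3' j : j \notin writes (probe rRho rL) -> j \notin writes clean -> rg s3 j = r j.
    by move=> X1 X2; rewrite H1 // F1 //=; case: eqP X1 => // ->.
  have Rb : rg s3 rBest = rg s1 rBest by rewrite H1.
  have Ed3 : ar s3 1 = a 1 by rewrite H2 // F2.
  split; rewrite ?R3' //; split=> //; split=> /=; rewrite ?Rb.
  + split; last by rewrite Ed3.
    split; split=> //=; rewrite ?Rb ?Ed3 ?R3' //.
    by case: B2 => [->|]; [|right].
  + exact: leq_trans B1 Hb.
  + by rewrite /= !R3'.
  + move=> c u Hc /andP[Sc Sc8] Hu; rewrite ltnS leq_eqVlt => /orP[/eqP Eu|Hui]; last first.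
      by apply: leq_trans B1 (Hcy c u Hc _ Hu Hui); rewrite Sc.
    have [Hall|] := boolP (all (fun x => a 1 x < rho) c); last first.
      case/allPn=> x Hx; rewrite -leqNgt => Hle.
      by apply: leq_trans (leq_trans B1 Hb) (dead_case x c _ _ _ _).
    have Hc' : ucycle (edge N (fun x => a 1 x < rho)) c.
      by apply: edge_ucycle Hc _ => x; apply: (allP Hall).
    have Hw : within (edge N (fun x => a 1 x < rho)) 0 i u by rewrite Eu; apply: within0.
    have [H|[Et Hdep]] := B8 c 0 u Hc' Sc Hu Hw; first by move: H; rewrite double0 addn0; lia.
    have Hall2 x : (x < n) && (a 1 x < rho) ->
        rg s rBest <= rho.*2 \/ small (edge N (fun x => a 1 x < rho)) rho x S.
      by case/andP=> Hx Hl; have := Hsm x Hx; rewrite /small_live /live -Ed => -[|/(_ Hl)]; [left|right].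
    have [Hle|Hgt] := leqP (rg s rBest) rho.*2.
      by apply: leq_trans (leq_trans B1 Hb) _; lia.
    have Hsmall : small (edge N (fun x => a 1 x < rho)) (4 * rho) i (S ^ 4).
      apply: (small_mul (P := fun x => (x < n) && (a 1 x < rho))).
      * by move=> x y _ /and3P[/(ng_lt G)-> _ ->].
      * by move=> x /Hall2[]//; rewrite leqNgt Hgt.
      * by rewrite Hi.
    have := Bsz _ _ Hsmall; rewrite Et add0n in Hdep *; move=> H.
    have : S ^ 4 + 1 <= S ^ 4 by apply: H; apply: leq_trans Hdep _; lia.
    by lia.
  + by move: Hclk Hclk1 Hc3; rewrite /probe_time /= mulSn; lia.
- move=> s' [_ [[Hok' Ed] Hb Hr' Hcy Hclk]]; apply: HQ => //=.
  + by move=> c Hc Sc; case: c Hc Sc => // x c Hc Sc; apply: (Hcy _ x Hc Sc (mem_head _ _)); apply: cycle_lt G Hc (mem_head _ _).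
  + by rewrite /pass2_time; lia.
Qed.

End FixedRadius.

Definition round_time := pass1_time + pass2_time + 20.

Definition rounds_inv (rho : nat) (s : hst) : Prop :=
  [/\ ok s, [/\ rg s rRho = rho, rg s rS = S & rg s rL = S ^ 4 + 1],
    forall x, x < n -> ar s aDead x = n.+1 \/ (ar s aDead x < rho /\ size (N x) <= D),
    covers N (rg s rBest) 0 (fun x => ar s aDead x != n.+1) &
    forall c : seq nat, ucycle E c -> 3 < size c < 4 * rho -> 5 * rg s rBest <= 8 * size c].

Lemma round_spec rho s (Q : hst -> Prop) : 0 < rho <= n -> rounds_inv rho s ->
  (forall s', rounds_inv (rho + rho) s' -> clk s' <= clk s + round_time -> Q s') ->
  wp round s Q.
Proof.
move=> Hrho [Hok Hr HD Hc0 Hcy] HQ; have Hnb := ig_nbase IG.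
have Hst : round_st n N D S rho s.
  split=> // [x /HD[|[H1 H2]]|c Hc Sc]; [by left | right; split=> //; exact: ltnW |].
  have [H|H] := Hc0 c Hc Sc; first by left; apply: leq_trans H _; lia.
  right=> x Hx; have := H x Hx; have [->|[//]] := HD x (cycle_lt G Hc Hx).
  by rewrite eqxx.
apply: wp_seq; apply: (pass1_spec Hrho Hst) => s1 Hst1 Hb1 Hsm Hclk1.
apply: wp_seq; apply: (pass2_spec Hrho Hst1 Hsm) => s2 Hok2 Ed Hb2 [Rr RS RL] Hcy2 Hclk2.
have [_ _ HD1 Hc1 _] := Hst1.
apply: wp_blk => /=; first by rewrite Rr; lia.
apply: HQ; last by rewrite /round_time /=; lia.
split=> /=.
- by case: Hok2 => [[? ? ? ? ?] [? ? ?]]; split.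
- by rewrite Rr.
- by move=> x /HD1; rewrite Ed => -[|[H1 H2]]; [left | right; split=> //; lia].
- by rewrite Ed; exact: covers_best Hc1.
- move=> c Hc Sc; have [Hlt|Hge] := ltnP (size c) (4 * rho).
    have Hs : 3 < size c < 4 * rho by lia.
    by apply: leq_trans (Hcy c Hc Hs); rewrite leq_mul2l (leq_trans Hb2 Hb1) orbT.
  have Hs8 : 2 < size c <= 8 * rho by lia.
  have := Hcy2 c Hc Hs8; have := odd_double_half (size c).
  by case: (odd (size c)) => /=; lia.
Qed.

Lemma rounds_spec s (Q : hst -> Prop) :
  rounds_inv 1 (HSt (update (rg s) rRho 1) (ar s) (clk s)) ->
  (forall s', ok s' ->
    (forall c : seq nat, ucycle E c -> 3 < size c -> 5 * rg s' rBest <= 8 * size c) ->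
    clk s' <= clk s + 10 + (trunc_log 2 n).+1 * (round_time + 5) -> Q s') ->
  wp rounds s Q.
Proof.
move=> HI HQ; have Hnb := ig_nbase IG.
pose Inv s' := exists2 i, rounds_inv (2 ^ i) s' &
   clk s' <= clk s + 2 + i * (round_time + 2) /\ i <= (trunc_log 2 n).+1.
have inv_clk rho x a t t' r : rounds_inv rho (HSt (update r rRho x) a t) -> rounds_inv rho (HSt (update r rRho x) a t').
  by case=> [[[? ? ? ? ?] [? ? ?]] ? ? ? ?]; split=> //; split.
apply: wp_seq; rewrite /setc; apply: wp_blk => /=; first lia.
apply: (@wp_while _ _ _ Inv (clk s + 2 + (trunc_log 2 n).+1 * (round_time + 2))).
- exists 0; [exact: inv_clk HI | by rewrite /=; split=> //; lia].
- move=> s' [i _ [Hc Hi]].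
  have : i * (round_time + 2) <= (trunc_log 2 n).+1 * (round_time + 2) by rewrite leq_mul2r Hi orbT.
  by lia.
- move=> s' [i I [Hc Hi]] Hlt; have [[[R1 R2 R3 R22 R23] _] [Rr _ _] _ _ _] := I.
  rewrite Rr R22 ltnS in Hlt.
  have Hpos : 0 < 2 ^ i by rewrite expn_gt0.
  have Hi' : i <= trunc_log 2 n by apply: trunc_log_max.
  apply: (round_spec (rho := 2 ^ i)); first by rewrite Hpos.
    by case: s' I {Hc Rr R1 R2 R3 R22 R23}.
  move=> s2 I2 Hc2; exists i.+1.
    by rewrite expnS mul2n -addnn; case: s2 I2 {Hc2}.
  by split=> //; move: Hc Hc2 => /=; rewrite mulSn; lia.
- move=> s' [i I [Hc Hi]] Hge; have [Hok [Rr _ _] _ _ Hcy] := I.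
  have [[R1 R2 R3 R22 R23] _] := Hok.
  rewrite Rr R22 in Hge; apply: HQ.
  + by case: s' Hok {I Rr R1 R2 R3 R22 R23 Hc Hcy}.
  + move=> c Hc' Sc; apply: Hcy => //; rewrite Sc /=.
    have : size c <= n.
      rewrite -(size_iota 0 n); apply: uniq_leq_size; first by case/andP: Hc'.
      by move=> x Hx; rewrite mem_iota (cycle_lt G Hc' Hx).
    by move=> Hs; apply: leq_ltn_trans Hs _; lia.
  + have : i * (round_time + 2) <= (trunc_log 2 n).+1 * (round_time + 2) by rewrite leq_mul2r Hi orbT.
    by move: Hc => /=; lia.
Qed.

End Round.
End Passes.

(** * The whole program *)

Local Notation rB := 26. Local Notation rB1 := 27. Local Notation rP12 := 28. Local Notation rH := 29.
Local Notation rP2 := 30. Local Notation rP4 := 31. Local Notation rP8 := 32. Local Notation rP7 := 33.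
Local Notation rP14 := 34. Local Notation rDl := 35. Local Notation rX1 := 36. Local Notation rX2 := 37.

Definition main_init := Blk
  [:: BInp rN rZero; BConst rOne 1; BAdd rInf rN rOne; BAdd rInf2 rInf rOne;
      BAdd rBest rInf rInf; BConst rB 1].

Definition pow12 := Blk
  [:: BAdd rB1 rB rOne; BMul rP2 rB1 rB1; BMul rP4 rP2 rP2; BMul rP8 rP4 rP4;
      BMul rP12 rP8 rP4].

Definition root12 := Seq pow12 (While rP12 rInf (Seq (Blk [:: BAdd rB rB1 rZero]) pow12)).

Definition set_bounds := Blk
  [:: BMul rP2 rB rB; BMul rP4 rP2 rP2; BMul rP7 rP4 rP2; BMul rP7 rP7 rB;
      BMul rP14 rP7 rP7; BAdd rS rB rZero; BAdd rL rP4 rOne; BAdd rDl rP7 rOne].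

Definition if_high (c : cmd) := Seq (Blk
  [:: BAdd rT rV rOne; BInp rP rT; BAdd rP rP rDl; BAdd rT rT rOne; BInp rM rT])
  (If rM rP skip c).

Definition count_high := for_vertices (if_high (Blk [:: BAdd rH rH rOne])).

Definition pass0 := for_vertices (if_high (Seq full_search (Blk [:: BSet aDead rV rInf]))).

Definition main :=
  Seq main_init (Seq root12 (Seq set_bounds (Seq count_high
  (Seq (Blk [:: BMul rX1 rN rN; BMul rX2 rH rP14])
  (If rX1 rX2 (setc rOut 4)
    (Seq pass0 (Seq rounds
      (If rBest rInf (Blk [:: BAdd rOut rBest rZero]) skip)))))))).

Section Main.
Variables (W base n : nat) (inp : nat -> nat) (N : nat -> seq nat).
Hypothesis IG : input_graph n base inp N.
Hypothesis HW : 100 * base <= W.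
Hypothesis HW2 : 5000 * (n + 2) ^ 3 <= W.
Let G := ig_graph IG.
Notation wp := (wp W base inp).
Notation E := (edge N xpredT).
Notation ok := (ok n N).

Lemma root12_spec s (Q : hst -> Prop) :
  rg s rZero = 0 -> rg s rOne = 1 -> rg s rB = 1 -> rg s rInf = n.+1 ->
  (forall s', 0 < rg s' rB -> n < (rg s' rB).+1 ^ 12 -> rg s' rB = 1 \/ rg s' rB ^ 12 <= n ->
     clk s' <= clk s + 10 + 20 * rg s' rB -> Q s') ->
  wp root12 s Q.
Proof.
move=> R2 R3 RB R22 HQ; have Hn2 : n < (n + 2) ^ 3 by rewrite !expnS expn0; nia.
have pow_ok s' (Q' : hst -> Prop) : rg s' rOne = 1 -> 0 < rg s' rB ->
    rg s' rB = 1 \/ rg s' rB ^ 12 <= n ->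
    (forall s'', rg s'' rB1 = rg s' rB + 1 -> rg s'' rP12 = (rg s' rB + 1) ^ 12 ->
       (forall j, j \notin [:: rB1; rP2; rP4; rP8; rP12] -> rg s'' j = rg s' j) ->
       clk s'' = clk s' + 5 -> Q' s'') -> wp pow12 s' Q'.
  move=> R3' Hb0 Hb HQ'.
  have HX : (rg s' rB + 1) ^ 12 < W.
    apply: (@leq_ltn_trans ((2 * rg s' rB) ^ 12)); first by rewrite leq_exp2r //; lia.
    rewrite expnMn; apply: leq_trans HW2.
    have -> : 2 ^ 12 = 4096 by [].
    case: Hb => [->|Hb]; rewrite ?exp1n; lia.
  set x := rg s' rB + 1 in HX HQ'; have Hx : 0 < x by rewrite /x addn1.
  have e2 : x * x = x ^ 2 by rewrite mulnn.
  have e4 : x ^ 2 * x ^ 2 = x ^ 4 by rewrite -expnD.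
  have e8 : x ^ 4 * x ^ 4 = x ^ 8 by rewrite -expnD.
  have e12 : x ^ 8 * x ^ 4 = x ^ 12 by rewrite -expnD.
  have le k : k <= 12 -> x ^ k < W by move=> Hk; apply: leq_ltn_trans HX; rewrite leq_pexp2l.
  apply: wp_blk => /=.
    rewrite R3' -/x e2 e4 e8 e12; do !split; try exact: le.
    by have := le 1 isT; rewrite expn1.
  apply: HQ' => /=; rewrite ?R3' -/x ?e2 ?e4 ?e8 ?e12 //; last lia.
  by move=> j; rewrite !inE !negb_or => /and5P[/negbTE-> /negbTE-> /negbTE-> /negbTE-> /negbTE->].
pose Inv s' := [/\ rg s' rZero = 0, rg s' rOne = 1, rg s' rInf = n.+1,
   0 < rg s' rB /\ (rg s' rB = 1 \/ rg s' rB ^ 12 <= n) &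
   [/\ rg s' rB1 = rg s' rB + 1, rg s' rP12 = (rg s' rB + 1) ^ 12 &
     clk s' <= clk s + 20 * rg s' rB]].
apply: wp_seq; apply: (pow_ok); rewrite ?RB //; first by left.
move=> s1 H1 H2 H3 H4.
apply: (@wp_while _ _ _ Inv (clk s + 20 * (n + 1))).
- have S3 : rg s1 rB = 1 by rewrite H3.
  split; rewrite ?S3; [by rewrite H3 | by rewrite H3 | by rewrite H3 | by split=> //; left |].
  by split; [rewrite H1 | rewrite H2 | lia].
- move=> s' [_ _ _ [Hb0 Hb] [_ _ Hc]].
  have : rg s' rB <= n + 1.
    case: Hb => [->|Hb]; first by rewrite addn1.
    by apply: leq_trans (leq_addr _ _); apply: leq_trans Hb; rewrite -{1}(expn1 (rg s' rB)) leq_pexp2l.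
  lia.
- move=> s' [S2 S3 S22 [Hb0 Hb] [Hb1 Hp Hc]]; rewrite Hp S22 ltnS => Hlt.
  apply: wp_seq; apply: wp_blk => /=.
    split=> //; rewrite S2 Hb1 addn0; apply: leq_ltn_trans (leq_trans _ HW2).
      by apply: leq_trans Hlt; rewrite -{1}(expn1 (rg s' rB + 1)) leq_pexp2l // addn1.
    lia.
  apply: (pow_ok) => /=; rewrite ?S2 ?Hb1 ?addn0 //; [lia | by right |].
  move=> s2 G1 G2 G3 G4.
  have B2 : rg s2 rB = rg s' rB + 1 by rewrite G3.
  split; rewrite /= ?B2; [by rewrite G3 | by rewrite G3 | by rewrite G3 | by split; [lia | right] |].
  by split=> //; lia.
- move=> s' [S2 S3 S22 [Hb0 Hb] [Hb1 Hp Hc]]; rewrite Hp S22 => Hge.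
  by rewrite addn1 in Hge; apply: HQ => /=; [ | | | lia].
Qed.

Section High.
Variable D : nat.
Hypothesis HD : D + 1 <= n + 2.

Definition high (x : nat) : bool := D < size (N x).

Definition n_high (i : nat) : nat := count high (iota 0 i).

Lemma n_highS i : n_high i.+1 = n_high i + high i.
Proof. by rewrite /n_high -addn1 iotaD count_cat /= addn0. Qed.

Lemma if_high_spec c s v (Q : hst -> Prop) :
  rg s rOne = 1 -> rg s rV = v -> v < n -> rg s rDl = D + 1 ->
  (forall s', (forall j, j \notin [:: rT; rP; rM] -> rg s' j = rg s j) -> ar s' = ar s ->
     clk s' = clk s + 6 ->
     (high v -> wp c s' (fun s'' => Q (tick 1 s''))) /\ (~~ high v -> Q s')) ->
  wp (if_high c) s Q.
Proof.
move=> R3 R4 Hv Rd H; have Hnb := ig_nbase IG.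
have Ho := ig_off IG Hv; have Hb := ig_base IG Hv.
apply: wp_seq; apply: wp_blk => /=; first by rewrite R3 R4 Rd !addn1; lia.
rewrite R3 R4 Rd !addn1; set s1 := HSt _ _ _.
have Hfr j : j \notin [:: rT; rP; rM] -> rg s1 j = rg s j.
  by rewrite !inE !negb_or /s1 /= => /and3P[/negbTE-> /negbTE-> /negbTE->].
have [|//||H1 H2] := H (tick 1 s1); [by [] | by rewrite /s1 /=; lia |].
apply: wp_if; rewrite {1 2}/s1 /= Ho => Hlt.
  by apply: wp_blk => //=; apply: H2; rewrite /high; lia.
by apply: H1; rewrite /high; lia.
Qed.

Lemma count_high_spec s (Q : hst -> Prop) :
  rg s rN = n -> rg s rOne = 1 -> rg s rDl = D + 1 -> rg s rH = 0 ->
  (forall s', rg s' rH = n_high n -> clk s' <= clk s + 10 + 20 * n -> Q s') ->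
  wp count_high s Q.
Proof.
move=> R1 R3 Rd Rh HQ; have Hnb := ig_nbase IG.
have Hcnt i : n_high i <= i by rewrite /n_high -[X in _ <= X](size_iota 0 i) count_size.
pose I i s' := [/\ rg s' rN = n, rg s' rOne = 1, rg s' rDl = D + 1, rg s' rH = n_high i &
  clk s' <= clk s + 1 + 20 * i].
apply: (for_vertices_spec IG HW (I := fun i s' => i <= n /\ I i s') (B := clk s + 10 + 20 * n)).
- by split=> //; split=> //=; lia.
- by move=> i s' [Hi [? _ _ _ Hc]]; split=> //; lia.
- move=> i s' [_ [S1 S3 Sd Sh Sc]] S4 Hi.
  apply: (if_high_spec (v := i)) => //= s1 F _ Hc; split=> Hh.
    apply: wp_blk => /=; first by rewrite !F //= Sh S3; have := Hcnt i; lia.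
    split; rewrite ?F //=; split=> //; split; rewrite /= ?F //=; last lia.
    by rewrite Sh S3 n_highS Hh.
  split; rewrite ?F //=; split=> //; split; rewrite /= ?F //=; last lia.
  by rewrite Sh n_highS (negbTE Hh) addn0.
- by move=> s' [_ [_ _ _ Sh Sc]]; apply: HQ => //=; lia.
Qed.

Lemma pass0_spec s (Q : hst -> Prop) : ok s -> rg s rDl = D + 1 -> ar s aDead = (fun=> 0) ->
  (forall s', ok s' -> (forall x, x < n -> ar s' aDead x = n.+1 \/ (ar s' aDead x < 1 /\ size (N x) <= D)) ->
    covers N (rg s' rBest) 0 (fun x => ar s' aDead x != n.+1) ->
    clk s' <= clk s + 10 + 40 * n + n_high n * (probe_time n 0 n.+1 true + 20) -> Q s') ->
  wp pass0 s Q.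
Proof.
move=> Hok Rd Hdead HQ; have Hnb := ig_nbase IG.
set CF := probe_time n 0 n.+1 true + 20 in HQ *.
pose I i s' := [/\ ok s', rg s' rDl = D + 1,
  forall x, ar s' aDead x = if (x < i) && high x then n.+1 else 0,
  covers N (rg s' rBest) 0 (fun x => ~~ ((x < i) && high x)) &
  clk s' <= clk s + 1 + 40 * i + n_high i * CF].
have Hcnt i : i <= n -> n_high i <= n_high n.
  by move=> Hi; rewrite /n_high -(subnKC Hi) iotaD count_cat leq_addr.
apply: (for_vertices_spec IG HW (I := fun i s' => i <= n /\ I i s')
  (B := clk s + 10 + 40 * n + n_high n * CF)).
- split=> //; move: Hok => [[? ? ? ? ?] [? ? ?]].
  split=> /=; [by split; split | by [] | by rewrite Hdead | by move=> c _ _; right | by lia].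
- move=> i s' [Hi [[[R1 _ _ _ _] _] _ _ _ Hc]]; split=> //.
  have : n_high i * CF <= n_high n * CF by rewrite leq_mul2r Hcnt ?orbT.
  lia.
- move=> i s' [_ [Hok' Sd Hdd Hcv Hc]] S4 Hi.
  have [[R1 R2 R3 R22 R23] [Hpos Hle Hb]] := Hok'.
  apply: (if_high_spec (v := i)) => //= s1 F Fa Hc1; split=> Hh; last first.
    have Hx x : (x < i.+1) && high x = (x < i) && high x.
      rewrite ltnS leq_eqVlt; case: eqP => [->|//].
      by rewrite (negbTE Hh) !andbF.
    split; rewrite ?F //=; split=> //; split; rewrite /= ?F ?Fa //=.
    + by split; split; rewrite /= ?F ?Fa.
    + by move=> x; rewrite Hx.
    + by move=> c Hc' Sc; have [?|H] := Hcv c Hc' Sc; [left | right=> x; rewrite Hx; exact: H].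
    + by rewrite n_highS (negbTE Hh) addn0; lia.
  apply: wp_seq; apply: wp_frame; apply: (full_search_spec IG HW (v := i)) => //=.
  + by split; split; rewrite /= ?F ?Fa.
  + by rewrite F.
  move=> s2 Hok2 Ed2 Hb2 Hfull Hc2 F2 Fa2; have [[T1 T2 T3 T22 T23] [Hp2 Hd2 Hbb2]] := Hok2.
  have V2 : rg s2 rV = i by rewrite F2 // F.
  apply: wp_blk => /=; first by rewrite V2; lia.
  have Hx x : (x < i.+1) && high x = (x == i) || ((x < i) && high x).
    by rewrite ltnS leq_eqVlt; case: eqP => [->|//]; rewrite Hh.
  split=> //; split=> //; split=> /=.
  + split; split=> //= x; rewrite T22 V2; case: eqP => // _; exact: Hd2.
  + by rewrite F2 // F.
  + by move=> x; rewrite V2 T22 Hx Ed2 Fa Hdd; case: eqP.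
  + move=> c Hc' Sc; have [Hin|Hnin] := boolP (i \in c).
      by left; apply: (Hfull c 0 i Hc' Sc Hin); exact: within0.
    have [Hl|H] := Hcv c Hc' Sc.
      by left; apply: leq_trans Hl; rewrite F in Hb2.
    right=> x Hxc; rewrite Hx negb_or H // andbT.
    by apply: contraNneq Hnin => <-.
  + by rewrite n_highS Hh mulnDl mul1n; move: Hc2; rewrite /CF /=; lia.
- move=> s' [_ [Hok' _ Hdd Hcv Hc]]; apply: HQ => //=.
  + move=> x Hx; rewrite Hdd Hx /=; case: ifP => Hh; first by left.
    by right; split=> //; rewrite leqNgt; move: Hh; rewrite /high => ->.
  + move=> c Hc' Sc; have [Hl|H] := Hcv c Hc' Sc; [by left | right=> x Hxc].
    by rewrite Hdd (negbTE (H x Hxc)).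
  + by lia.
Qed.

End High.
End Main.

Section Main.
Variables (W base n : nat) (inp : nat -> nat) (N : nat -> seq nat).
Hypothesis IG : input_graph n base inp N.
Hypothesis HW : 100 * base <= W.
Hypothesis HW2 : 5000 * (n + 2) ^ 3 <= W.
Let G := ig_graph IG.
Notation wp := (wp W base inp).
Notation E := (edge N xpredT).

Definition main_time (b h : nat) : nat :=
  100 + 20 * b + 60 * n + h * (probe_time n 0 n.+1 true + 20) +
  (trunc_log 2 n).+1 * (round_time n (b ^ 7) b + 5).

Definition answer (out : nat) : Prop :=
  [\/ exists D, n ^ 2 < n_high N D n * D ^ 2 /\ out = 4,
      [/\ has_ncycle N out & forall c : seq nat, ucycle E c -> 3 < size c -> 5 * out <= 8 * size c] |
      out = 0 /\ forall c : seq nat, ucycle E c -> 3 < size c -> False].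

Lemma main_spec :
  wp main (HSt (fun=> 0) (fun _ _ => 0) 0) (fun s' => answer (rg s' rOut) /\
    rg s' rOut <= n + 4 /\
    exists b h, [/\ 0 < b, n < b.+1 ^ 12, b = 1 \/ b ^ 12 <= n, h * (b ^ 7) ^ 2 <= n ^ 2 &
      clk s' <= main_time b h]).
Proof.
have Hnb := ig_nbase IG.
have Hn3 : n < (n + 2) ^ 3 by rewrite !expnS expn0; nia.
apply: wp_seq; apply: wp_blk => /=; first by rewrite (ig_n IG); lia.
rewrite (ig_n IG) !addn0 !addn1; apply: wp_seq; apply: wp_frame.
apply: (root12_spec inp HW HW2) => //= s1 Hb0 Hn Hb Hc1 F1 A1.
move: Hb0 Hn Hb Hc1; set b := rg s1 rB => Hb0 Hn Hb Hc1.
have le_b k : k <= 12 -> b ^ k <= n.+1.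
  move=> Hk; case: Hb => [->|Hb]; first by rewrite exp1n.
  by apply: leqW; apply: leq_trans Hb; rewrite leq_pexp2l.
have le_14 : b ^ 14 <= (n + 2) ^ 2.
  case: Hb => [->|Hb]; first by rewrite exp1n expn_gt0 addn2.
  apply: (@leq_trans ((b ^ 12) ^ 2)); first by rewrite -expnM leq_pexp2l.
  by rewrite leq_exp2r //; lia.
set D := b ^ 7.
have HD : D + 1 <= n + 2 by have := le_b 7 isT; rewrite -/D; lia.
have D2 : D ^ 2 = b ^ 14 by rewrite -expnM.
have e1 : b * b = b ^ 2 by rewrite mulnn.
have e2 : b ^ 2 * b ^ 2 = b ^ 4 by rewrite -expnD.
have e3 : b ^ 4 * b ^ 2 = b ^ 6 by rewrite -expnD.
have e4 : b ^ 6 * b = D by rewrite -expnSr.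
have e5 : D * D = D ^ 2 by rewrite mulnn.
have W14 k : b ^ k <= (n + 2) ^ 2 -> b ^ k < W.
  move=> H; apply: leq_ltn_trans H _; apply: leq_trans HW2; rewrite [(n + 2) ^ 3]expnS; nia.
have W12 k : k <= 12 -> b ^ k < W by move=> /le_b; lia.
apply: wp_seq; apply: wp_blk => /=.
  rewrite !(F1 rOne) // !(F1 rZero) //= -/b e1 e2 e3 e4 e5.
  have := W12 4 isT; have := le_b 1 isT; have := le_b 4 isT; rewrite expn1 => ? ? ?.
  by do !split; rewrite ?D2; try exact: W12; try exact: W14; rewrite -?/D; lia.
rewrite !(F1 rOne) // !(F1 rZero) //= -/b e1 e2 e3 e4 e5 addn0.
apply: wp_seq; apply: wp_frame.
apply: (count_high_spec IG HW HW2 HD) => //=; try by rewrite F1.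
move=> s2 Hh Hc2 F2 A2.
have Hhn : n_high N D n <= n by rewrite /n_high -[X in _ <= X](size_iota 0 n) count_size.
have hW : n_high N D n * D ^ 2 < W.
  apply: (@leq_ltn_trans (n * (n + 2) ^ 2)); first by rewrite leq_mul // D2.
  have : 0 < (n + 2) ^ 2 by rewrite expn_gt0 addn2.
  by move=> Hp; apply: leq_trans HW2; rewrite [(n + 2) ^ 3]expnS; nia.
have S1 : rg s2 rN = n by rewrite F2 //= F1.
have S14 : rg s2 rP14 = D ^ 2 by rewrite F2.
apply: wp_seq; apply: wp_blk => /=.
  rewrite S1 S14 Hh; split; last by split.
  by apply: leq_trans HW2; rewrite !expnS expn0; nia.
rewrite S1 S14 Hh; apply: wp_if => /= Hcmp.
  rewrite /setc; apply: wp_blk => /=; first lia.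
  split; first by apply: Or31; exists D; rewrite -mulnn.
  split; first lia.
  exists b, 0; split=> //; rewrite /main_time; lia.
have Hok : ok n N s2.
  split; first by split; rewrite F2 //= F1.
  by rewrite !A2 //= !A1 //; split=> //; left; rewrite F2 //= F1 //= addSnnS.
apply: wp_seq; apply: wp_frame; apply: (pass0_spec IG HW HW2 HD) => //=.
- by rewrite F2.
- by rewrite A2 //= A1.
move=> s3 Hok3 Hd3 Hcv3 Hc3 F3 A3.
have RS : rg s3 rS = b by rewrite F3 //= F2.
have RL : rg s3 rL = b ^ 4 + 1 by rewrite F3 //= F2.
have [[T1 T2 T3 T22 T23] [P1 P2 P3]] := Hok3.
have b4 : b ^ 4 < base by have := le_b 4 isT; lia.
apply: wp_seq; apply: wp_frame; apply: (rounds_spec IG HW (D := D) (S := b) Hb0 b4).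
- split=> /=.
  + by split; split.
  + by rewrite RS RL.
  + exact: Hd3.
  + exact: Hcv3.
  + by move=> c _; lia.
move=> s4 Hok4 Hcy Hc4 F4 A4; have [[U1 U2 U3 U22 U23] [_ _ Ub]] := Hok4.
have size_le (c : seq nat) : ucycle E c -> size c <= n.
  move=> Hc; rewrite -(size_iota 0 n); apply: uniq_leq_size; first by case/andP: Hc.
  by move=> x Hx; rewrite mem_iota (cycle_lt G Hc Hx).
have time_ok t : t <= clk s4 + 10 -> exists b0 h, [/\ 0 < b0, n < b0.+1 ^ 12,
    b0 = 1 \/ b0 ^ 12 <= n, h * (b0 ^ 7) ^ 2 <= n ^ 2 & t <= main_time b0 h].
  move=> Ht; exists b, (n_high N D n); split=> //.
  by rewrite /main_time -/D; lia.
apply: wp_if => /=; rewrite U22 => Hfound.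
  apply: wp_blk => /=; first by rewrite U2; lia.
  rewrite U2 addn0; split; last by split; [lia | apply: time_ok; lia].
  apply: Or32; split=> //; case: Ub => // Hx; lia.
apply: wp_blk => //=.
split; last by split; [rewrite F4 //= F3 //= F2 //= F1 | apply: time_ok; lia].
apply: Or33; split; first by rewrite F4 //= F3 //= F2 //= F1.
move=> c Hc Sc; have := Hcy c Hc Sc; have := size_le c Hc.
case: Ub => [-> | [c' [Sc' _ Hc']]]; first lia.
by have := size_le c' Hc'; lia.
Qed.

End Main.

(** * Graphs with many vertices of high degree *)

Lemma many_high_four_cycle n N D : nat_graph n N -> n ^ 2 < n_high N D n * D ^ 2 -> has_ncycle N 4.
Proof.
move=> G Hlt.
pose S := [seq (x, p) | x <- filter (high N D) (iota 0 n),
                        p <- [seq (a, b) | a <- N x, b <- rem a (N x)]].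
have US : uniq S.
  apply: allpairs_uniq_dep; first by rewrite filter_uniq ?iota_uniq.
    move=> x _; apply: allpairs_uniq_dep; first exact: (ng_uniq G).
      by move=> a _; apply: rem_uniq; exact: (ng_uniq G).
    by move=> [a b] [a' b'] _ _ /= [-> ->].
  by move=> [x p] [x' p'] _ _ /= [-> ->].
have inS x a b : (x, (a, b)) \in S -> [/\ a \in N x, b \in N x & a != b].
  case/allpairsPdep=> x' [p [_ /allpairsPdep[a' [b' [Ha Hb ->]]] [-> -> ->]]].
  by move: Hb; rewrite (mem_rem_uniq _ (ng_uniq G _)) inE eq_sym => /andP[].
have SS : n_high N D n * D ^ 2 <= size S.
  rewrite size_allpairs_dep /n_high -size_filter.
  elim: (filter _ _) (filter_all (high N D) (iota 0 n)) => //= x s IH /andP[Hx /IH {}IH].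
  rewrite mulSn leq_add // size_allpairs_dep.
  have -> : [seq size (rem a (N x)) | a <- N x] = nseq (size (N x)) (size (N x)).-1.
    apply: (@eq_from_nth _ 0); rewrite ?size_map ?size_nseq // => i Hi.
    by rewrite (nth_map 0) // size_rem ?mem_nth // nth_nseq Hi.
  rewrite sumn_nseq mulnC -mulnn; apply: leq_mul; rewrite /high in Hx; lia.
have /uniqPn : ~~ uniq (map snd S).
  apply: contraL Hlt => U; rewrite -leqNgt; apply: leq_trans SS _.
  rewrite -(size_map snd); have -> : n ^ 2 = size [seq (a, b) | a <- iota 0 n, b <- iota 0 n].
    by rewrite size_allpairs !size_iota mulnn.
  apply: uniq_leq_size => // p /mapP[[x [a b]] /inS[Ha Hb _] ->].
  by apply: allpairs_f; rewrite mem_iota ?(ng_lt G Ha) ?(ng_lt G Hb).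
case/(_ (0, 0))=> i [j [Hij]]; rewrite size_map => Hj Heq.
have Hi : i < size S := ltn_trans Hij Hj.
rewrite !(nth_map (0, (0, 0))) // in Heq.
move: (mem_nth (0, (0, 0)) Hi) (mem_nth (0, (0, 0)) Hj).
have : nth (0, (0, 0)) S i != nth (0, (0, 0)) S j by rewrite nth_uniq // ltn_eqF.
move: Heq; case: (nth _ S i) => x [a b] /=; case: (nth _ S j) => x' p /= <- Hne.
have {Hne} Hx : x != x' by apply: contraNneq Hne => ->.
move=> /inS[Ha Hb Hab] /inS[Ha' Hb' _].
have ne y z : z \in N y -> y != z by move=> H; apply: contraTneq H => ->; exact: (ng_irr G).
have Sa := ng_sym G Ha'; have Sb := ng_sym G Hb.
exists [:: x; a; x'; b]; split=> //; apply/andP; split.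
  by rewrite /= /edge Ha Sa Hb' Sb.
by rewrite /= !inE !negb_or (ne _ _ Ha) Hx (ne _ _ Hb) (ne _ _ Sa) Hab (ne _ _ Hb').
Qed.

(** * Encoding of the input *)

Section Encoding.
Variables (n : nat) (e : rel 'I_n) (adj : 'I_n -> seq 'I_n).
Hypotheses (e_sym : symmetric e) (e_irr : irreflexive e) (Hadj : adjacency_lists e adj).

Let lists := [seq [seq val u | u <- adj v] | v <- enum 'I_n].

Definition nat_adj : nat -> seq nat := nth [::] lists.

Lemma size_lists : size lists = n.
Proof. by rewrite size_map size_enum_ord. Qed.

Lemma size_shape : size (shape lists) = n.
Proof. by rewrite size_map size_lists. Qed.

Lemma nat_adjE (v : 'I_n) : nat_adj v = map val (adj v).
Proof. by rewrite /nat_adj (nth_map v) ?size_enum_ord // nth_ord_enum. Qed.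

Lemma mem_nat_adj (v u : 'I_n) : (val u \in nat_adj (val v)) = e v u.
Proof. by rewrite nat_adjE (mem_map val_inj) (Hadj v).2. Qed.

Lemma nat_adj_out x : n <= x -> nat_adj x = [::].
Proof. by move=> Hx; rewrite /nat_adj nth_default ?size_lists. Qed.

Lemma nat_adj_inP x y : y \in nat_adj x -> exists v u : 'I_n, [/\ val v = x, val u = y & e v u].
Proof.
have [Hx|Hx] := leqP n x; first by rewrite nat_adj_out.
rewrite -[x]/(val (Ordinal Hx)) nat_adjE => /mapP[u Hu ->].
by exists (Ordinal Hx), u; split=> //; rewrite -mem_nat_adj nat_adjE map_f.
Qed.

Lemma nat_adj_graph : nat_graph n nat_adj.
Proof.
split=> [x y|x y|x|x].
- by move=> /nat_adj_inP[v [u [_ <- _]]]; exact: ltn_ord.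
- by move=> /nat_adj_inP[v [u [<- <- Huv]]]; rewrite mem_nat_adj e_sym.
- by apply/negP => /nat_adj_inP[v [u [<- /val_inj->]]]; rewrite e_irr.
- have [Hx|Hx] := leqP n x; first by rewrite nat_adj_out.
  by rewrite -[x]/(val (Ordinal Hx)) nat_adjE (map_inj_uniq val_inj) (Hadj _).1.
Qed.

Lemma size_nat_adj x : size (nat_adj x) <= n.
Proof.
rewrite -[X in _ <= X](size_iota 0 n); apply: uniq_leq_size (ng_uniq nat_adj_graph x) _.
by move=> y /(ng_lt nat_adj_graph); rewrite mem_iota.
Qed.

Definition offset (x : nat) : nat := sumn (take x (shape lists)).

Lemma foldl_addn a s : foldl addn a s = a + sumn s.
Proof. by elim: s a => [|x s IH] a /=; rewrite ?addn0 // IH addnA. Qed.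

Lemma offsetS x : x < n -> offset x.+1 = offset x + size (nat_adj x).
Proof.
move=> Hx; rewrite /offset (take_nth 0) ?size_shape //.
by rewrite sumn_rcons (nth_map [::]) ?size_lists.
Qed.

Lemma offset_le x : x <= n -> offset x <= x * n.
Proof.
elim: x => [|x IH] Hx; first by rewrite /offset take0.
by rewrite offsetS // mulSn addnC leq_add ?IH ?size_nat_adj // ltnW.
Qed.

Lemma encode_off x : x <= n -> nth 0 (encode adj) x.+1 = n.+2 + offset x.
Proof.
case: x => [|x] Hx; first by rewrite /offset take0 addn0.
rewrite /encode -/lists [nth _ _ _]/= nth_cat size_scanl size_shape Hx.
by rewrite nth_scanl ?size_shape // foldl_addn.
Qed.

Lemma encode_list x k : x < n -> k < size (nat_adj x) ->
  nth 0 (encode adj) (n.+2 + offset x + k) = nth 0 (nat_adj x) k.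
Proof.
move=> Hx Hk; rewrite /encode -/lists -addnA [nth _ _ _]/= nth_cat size_scanl size_shape.
rewrite ltnNge leq_addr addKn nth_flatten.
have Hk' : k < nth 0 (shape lists) x by rewrite (nth_map [::]) ?size_lists.
by rewrite -[offset x + k]/(flatten_index (shape lists) x k) flatten_indexKl // flatten_indexKr.
Qed.

Lemma size_encode : size (encode adj) <= (n + 2) ^ 2.
Proof.
rewrite /encode -/lists /= size_cat size_scanl size_shape size_flatten.
have := offset_le (leqnn n); rewrite /offset take_oversize ?size_shape //.
by rewrite -mulnn; nia.
Qed.

Lemma encode_lt a : nth 0 (encode adj) a < (n + 2) ^ 2 + 1.
Proof.
rewrite -mulnn; have [Ha|Ha] := leqP (size (encode adj)) a; first by rewrite nth_default ?addn1.
move: Ha; rewrite /encode -/lists; case: a => [|[|a]]; rewrite /=; [nia | nia |].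
rewrite !ltnS size_cat size_scanl size_shape nth_cat size_scanl size_shape => Ha.
have [Han|Han] := ltnP a n.
  rewrite nth_scanl ?size_shape // foldl_addn.
  have := offset_le Han; rewrite /offset; have : a.+1 * n <= n * n by rewrite leq_mul2r Han orbT.
  by nia.
have Hin : nth 0 (flatten lists) (a - n) \in flatten lists by rewrite mem_nth // ltn_subLR.
have /flattenP[l /mapP[v _ ->] /mapP[u _ ->]] := Hin.
by have := ltn_ord u; rewrite /=; nia.
Qed.

Lemma encode_input_graph : input_graph n ((n + 2) ^ 2) (nth 0 (encode adj)) nat_adj.
Proof.
split=> //.
- exact: nat_adj_graph.
- move=> x Hx; rewrite !encode_off ?offsetS ?addnA //; exact: ltnW.
- by move=> x k Hx Hk; rewrite encode_off ?encode_list // ltnW.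
- move=> x Hx; rewrite encode_off ?(ltnW Hx) // -addnA -offsetS //.
  have := offset_le Hx; have : x.+1 * n <= n * n by rewrite leq_mul2r Hx orbT.
  by rewrite -mulnn; nia.
- by rewrite -mulnn; nia.
Qed.

Lemma cycle_lift (c : seq nat) : (forall x, x \in c -> x < n) -> exists c' : seq 'I_n, map val c' = c.
Proof.
elim: c => [|x c IH] H; first by exists [::].
have [c' <-] := IH (fun y Hy => H y (mem_behead (s := x :: c) Hy)).
by exists (Ordinal (H x (mem_head _ _)) :: c').
Qed.

Lemma ucycle_map_val (c : seq 'I_n) :
  ucycle (edge nat_adj xpredT) (map val c) = ucycle e c.
Proof.
rewrite /ucycle (map_inj_uniq val_inj) cycle_map; congr (_ && _).
by apply: eq_cycle => v u; rewrite /= /edge mem_nat_adj !andbT.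
Qed.

Lemma has_ncycleP k : has_ncycle nat_adj k <-> has_cycle e k.
Proof.
split=> [[c [Sc Hk Hc]]|[c [Sc Hk Hc]]].
  have [c' Ec] := cycle_lift (fun x => cycle_lt nat_adj_graph Hc (x := x)).
  by exists c'; split=> //; [rewrite -Sc -Ec size_map | rewrite -ucycle_map_val Ec].
by exists (map val c); rewrite size_map ucycle_map_val.
Qed.

End Encoding.

(** * Running time *)

Lemma main_time_bound : exists C, forall n b h, 0 < b -> n < b.+1 ^ 12 ->
  h * (b ^ 7) ^ 2 <= n ^ 2 ->
  main_time n b h <= C * ((trunc_log 2 n).+1 * (n.+1 * b ^ 11)).
Proof.
have [K HK] : exists K, forall b, 0 < b -> b.+1 ^ 12 <= K * b ^ 12.
  by exists (2 ^ 12) => b Hb; rewrite -expnMn leq_exp2r //; lia.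
exists (100 * (100 * (K * K + K + 100))) => n b h Hb Hn Hh.
set L := (trunc_log 2 n).+1; set X := n.+1 * b ^ 11.
have HnK : n <= K * b ^ 12 := ltnW (leq_trans Hn (HK b Hb)).
have bk k : k <= 11 -> b ^ k <= b ^ 11 by move=> H; rewrite leq_pexp2l.
have H1 : 1 <= b ^ 11 := bk 0 isT.
have Hbb : b <= b ^ 11 by have := bk 1 isT; rewrite expn1.
have hX : h <= K * K * b ^ 11.
  have H14 : 0 < b ^ 14 by rewrite expn_gt0 Hb.
  rewrite -(leq_pmul2r H14); apply: (@leq_trans (n ^ 2)); first by rewrite -expnM in Hh.
  apply: (@leq_trans (K * b ^ 12 * (K * b ^ 12))); first by rewrite -mulnn leq_mul.
  by rewrite mulnACA -expnD -[_ * b ^ 14]mulnA -expnD leq_mul2l leq_pexp2l ?orbT.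
have dX : n %/ b <= K * b ^ 11.
  rewrite -(leq_pmul2r Hb); apply: leq_trans (leq_divM _ _) _.
  by rewrite -mulnA -expnSr.
have full : probe_time n 0 n.+1 true <= 600 * n.+1.
  by rewrite /probe_time /search_time /bfs_time; lia.
have ps : probe_time n (b ^ 7) b false <= 1000 * b ^ 11.
  rewrite /probe_time /search_time /bfs_time mulnS -expnS; have := bk 8 isT.
  by have : minn n b <= b ^ 11; lia.
have pl : probe_time n (b ^ 7) (b ^ 4 + 1) false <= 1100 * b ^ 11.
  rewrite /probe_time /search_time /bfs_time mulnS mulnDl mul1n -expnD; have := bk 7 isT; have := bk 4 isT.
  by lia.
have HX : n.+1 <= X by rewrite leq_pmulr.
have HbX : b ^ 11 <= X by rewrite leq_pmull.
have nX : n * b ^ 11 <= X by rewrite leq_mul2r leqnSn orbT.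
have full20 : probe_time n 0 n.+1 true + 20 * (n + 5) <= 800 * n.+1 by lia.
have T1 : pass1_time n (b ^ 7) b <= (10 + 1060 + 800 * K) * X.
  rewrite /pass1_time.
  have A1 : n * (probe_time n (b ^ 7) b false + 60) <= 1060 * X.
    apply: (@leq_trans (n * (1060 * b ^ 11))); first by rewrite leq_mul2l; apply/orP; right; lia.
    by rewrite mulnCA leq_mul2l nX orbT.
  have A2 : n %/ b * (probe_time n 0 n.+1 true + 20 * (n + 5)) <= 800 * K * X.
    apply: leq_trans (leq_mul dX full20) _; rewrite /X; apply: eq_leq; lia.
  apply: leq_trans (leq_add (leq_add (_ : 10 <= 10 * X) A1) A2) _; first lia.
  by rewrite -!mulnDl.
have T2 : pass2_time n (b ^ 7) b <= (10 + 1160) * X.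
  rewrite /pass2_time.
  have A1 : n * (probe_time n (b ^ 7) (b ^ 4 + 1) false + 60) <= 1160 * X.
    apply: (@leq_trans (n * (1160 * b ^ 11))); first by rewrite leq_mul2l; apply/orP; right; lia.
    by rewrite mulnCA leq_mul2l nX orbT.
  by lia.
have T3 : round_time n (b ^ 7) b + 5 <= (3000 + 800 * K) * X.
  rewrite /round_time -addnA; apply: leq_trans (leq_add (leq_add T1 T2) (_ : _ <= 25 * X)) _.
    by lia.
  by rewrite -!mulnDl leq_mul2r; apply/orP; right; lia.
have T0 : h * (probe_time n 0 n.+1 true + 20) <= 700 * (K * K) * X.
  apply: leq_trans (leq_mul hX (_ : _ <= 700 * n.+1)) _; first by lia.
  by rewrite /X; apply: eq_leq; lia.
have LX : X <= L * X by rewrite leq_pmull.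
rewrite /main_time -/L.
have T4 : L * (round_time n (b ^ 7) b + 5) <= (3000 + 800 * K) * (L * X).
  by rewrite mulnCA leq_mul2l T3 orbT.
have T5 : h * (probe_time n 0 n.+1 true + 20) <= 700 * (K * K) * (L * X).
  by apply: leq_trans T0 _; rewrite leq_mul2l LX orbT.
have T6 : 100 + 20 * b + 60 * n <= 200 * (L * X) by lia.
apply: leq_trans (leq_add (leq_add T6 T5) T4) _.
by rewrite -!mulnDl leq_mul2r; apply/orP; right; lia.
Qed.

From mathcomp Require Import all_order all_algebra.
From mathcomp Require Import all_classical all_reals all_analysis.
From mathcomp Require Import lra ring.
Import Order.TTheory GRing.Theory Num.Theory.
Import numFieldNormedType.Exports.

Local Open Scope nat_scope.

Lemma exists_girth (V : finType) (e : rel V) k : has_cycle e k -> exists g, is_girth e g.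
Proof.
elim/ltn_ind: k => k IH Hk.
have [[k' [Hlt Hk']]|Hmin] := pselect (exists k', k' < k /\ has_cycle e k').
  exact: IH Hk'.
exists k; split=> // k' Hk'; rewrite leqNgt; apply/negP => Hlt.
by apply: Hmin; exists k'.
Qed.

Lemma triangle_free_cycle (V : finType) (e : rel V) k :
  triangle_free e -> has_cycle e k -> 3 < k.
Proof.
move=> Ht Hk; have [c [_ Hk2 _]] := Hk.
by rewrite ltn_neqAle Hk2 andbT; apply/eqP => E; apply: Ht; rewrite E.
Qed.

Section Correct.
Variables (n : nat) (e : rel 'I_n) (adj : 'I_n -> seq 'I_n).
Hypotheses (e_sym : symmetric e) (e_irr : irreflexive e) (e_free : triangle_free e).
Hypothesis (Hadj : adjacency_lists e adj).

Lemma answer_correct out : answer n (nat_adj adj) out ->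
  girth_approx e (8 / 5)%R out \/ acyclic e /\ out = 0.
Proof.
have cyc k : has_cycle e k -> exists c : seq nat,
    [/\ size c = k, ucycle (edge (nat_adj adj) xpredT) c & 3 < size c].
  move=> Hk; have [c [Sc H2 Hc]] := (has_ncycleP e_sym e_irr Hadj k).2 Hk.
  by exists c; rewrite Sc; split=> //; apply: triangle_free_cycle Hk.
have approx t : has_cycle e t -> (forall g, has_cycle e g -> 5 * t <= 8 * g) ->
    girth_approx e (8 / 5)%R t.
  move=> Ht Hall; split=> //; have [g Hg] := exists_girth Ht; exists g; split=> //.
    exact: Hg.2.
  have := Hall g Hg.1; rewrite -(ler_nat rat) !natrM; lra.
case=> [[D [Hlt ->]]|[Hc Hall]|[-> Hno]].
- left; apply: approx.
    by apply/(has_ncycleP e_sym e_irr Hadj); apply: (many_high_four_cycle (nat_adj_graph e_sym e_irr Hadj) Hlt).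
  by move=> g /(triangle_free_cycle e_free); lia.
- left; apply: approx; first exact/(has_ncycleP e_sym e_irr Hadj).
  by move=> g /cyc[c [<- Hcc Sc]]; apply: Hall.
- right; split=> // k /cyc[c [_ Hcc Sc]]; exact: Hno Hcc Sc.
Qed.

Lemma word_bound w : 20 * (trunc_log 2 n).+1 <= w ->
  5000 * (n + 2) ^ 3 <= 2 ^ w /\ 100 * (n + 2) ^ 2 <= 2 ^ w.
Proof.
move=> Hw; set a := 2 ^ (trunc_log 2 n).+1.
have Ha : n < a by apply: trunc_log_ltn.
have a2 : 2 <= a by rewrite /a expnS leq_pmulr // expn_gt0.
have H1 : n + 2 <= a ^ 2 by rewrite -mulnn; nia.
have H2 : 5000 <= a ^ 13 by apply: (@leq_trans (2 ^ 13)); rewrite ?leq_exp2r.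
have H3 : (n + 2) ^ 3 <= a ^ 6 by rewrite -[6]/(2 * 3) expnM leq_exp2r.
have H4 : 5000 * (n + 2) ^ 3 <= 2 ^ w.
  apply: (@leq_trans (a ^ 19)); first by rewrite -[19]/(13 + 6) expnD leq_mul.
  by rewrite /a -expnM leq_exp2l //; lia.
split=> //; apply: leq_trans H4; apply: leq_mul => //.
by rewrite leq_pexp2l // addn2.
Qed.

End Correct.

Local Open Scope classical_set_scope.
Local Open Scope ring_scope.

Definition root12_floor (n : nat) : nat := maxn 1 (\max_(i < n.+1 | (i ^ 12 <= n)%N) i)%N.

Lemma leq_root12_floor (n b : nat) : (b = 1 \/ b ^ 12 <= n -> b <= root12_floor n)%N.
Proof.
rewrite /root12_floor leq_max => -[->//|Hb].
have Hbn : (b < n.+1)%N.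
  rewrite ltnS; apply: leq_trans Hb; case: b => // b.
  by rewrite -{1}(expn1 b.+1) leq_pexp2l.
by rewrite (leq_bigmax_cond (Ordinal Hbn)) ?orbT.
Qed.

Lemma root12_floor_exp (n : nat) : (0 < n -> root12_floor n ^ 12 <= n)%N.
Proof.
have H : ((\max_(i < n.+1 | (i ^ 12 <= n)%N) i) ^ 12 <= n)%N.
  by elim/big_ind: _ => // x y Hx Hy; case: (leqP x y).
by move=> Hn; rewrite /root12_floor; case: (leqP 1 _) => _; rewrite ?exp1n.
Qed.

Lemma trunc_log_le_powR (R : realType) (n : nat) : (0 < n)%N ->
  ((trunc_log 2 n).+1)%:R <= 101 * (n%:R `^ (1 / 50)) :> R.
Proof.
move=> Hn; set k := trunc_log 2 n; set x : R := n%:R.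
have x1 : 1 <= x by rewrite ler1n.
have Hy : 1 <= x `^ (1 / 50) by rewrite -[X in X <= _](powRr0 x) ler_powR //; lra.
have Hk : k%:R * ln 2 <= ln x.
  rewrite mulr_natl -lnXn // ler_ln ?posrE ?exprn_gt0 //; last by lra.
  by rewrite -natrX ler_nat; exact: trunc_logP.
have Hl : ln x <= 50 * x `^ (1 / 50).
  have := ln_sublinear (x := x `^ (1 / 50)); rewrite ln_powR => /(_ (lt_le_trans ltr01 Hy)).
  by lra.
have Hl2 : 1 / 2 <= ln 2 :> R.
  have := le_ln1Dx (x := (- (1 / 2) : R)).
  have -> : 1 + - (1 / 2) = 2^-1 :> R by lra.
  rewrite lnV ?posrE //; lra.
rewrite -natr1.
have : k%:R * (1 / 2) <= k%:R * ln 2 :> R by rewrite ler_wpM2l.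
by lra.
Qed.

Lemma time_asymptotics (R : realType) (C : nat) (q : R) : 194 / 100 <= q ->
  (fun n : nat => ((C * ((trunc_log 2 n).+1 * (n.+1 * root12_floor n ^ 11)) + 10)%N)%:R : R^o)
    =O_\oo (fun n : nat => n%:R `^ q : R^o).
Proof.
move=> Hq; apply/eqO_exP; exists (202 * C%:R + 10 : R); first by rewrite ltr_wpDl // mulr_ge0 // ler0n.
near=> n.
have Hn : (0 < n)%N by near: n; exact: nbhs_infty_gt.
rewrite ger0_norm // ger0_norm ?powR_ge0 //.
set x : R := n%:R; have x1 : 1 <= x by rewrite ler1n.
have x0 : 0 <= x by lra.
rewrite natrD (natrM _ C) (natrM _ _.+1) (natrM _ _.+1) natrX.
set m : R := (root12_floor n)%:R.
have m0 : 0 <= m by rewrite ler0n.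
have Hm : m ^+ 11 <= x `^ (11 / 12).
  have -> : m ^+ 11 = (m ^+ 12) `^ (11 / 12).
    by rewrite -!powR_mulrn // -powRrM; congr powR; lra.
  rewrite ge0_ler_powR ?nnegrE ?exprn_ge0 //.
  by rewrite /m /x -natrX ler_nat root12_floor_exp.
have Hn1 : n.+1%:R <= 2 * x `^ 1 :> R by rewrite powRr1 // -natr1 -/x; lra.
have HL := trunc_log_le_powR R Hn.
have Hp : x `^ (1 / 50) * (x `^ 1 * x `^ (11 / 12)) <= x `^ q.
  by rewrite -!powRD ?gt_eqF ?implybT ?(lt_le_trans ltr01 x1) // ler_powR //; lra.
have H1 : 1 <= x `^ q by rewrite -[X in X <= _](powRr0 x) ler_powR //; lra.
rewrite mulrDl lerD //; last by lra.
rewrite [202 * C%:R]mulrC -[X in _ <= X]mulrA ler_wpM2l //.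
apply: (@le_trans _ _ ((101 * x `^ (1 / 50)) * ((2 * x `^ 1) * x `^ (11 / 12)))).
  by rewrite !ler_pM ?mulr_ge0 ?exprn_ge0.
have -> : 101 * x `^ (1 / 50) * (2 * x `^ 1 * x `^ (11 / 12)) =
  202 * (x `^ (1 / 50) * (x `^ 1 * x `^ (11 / 12))) by ring.
by rewrite ler_wpM2l.
Unshelve. all: by end_near.
Qed.

Unset Implicit Arguments.

Theorem theorem3 (R : realType) :
  exists (P : program) (c : nat) (T : nat -> nat),
    (fun n : nat => (T n)%:R : R^o)
      =O_\oo (fun n : nat => n%:R `^ (1942 / 1000) : R^o) /\
    forall (n : nat) (e : rel 'I_n) (adj : 'I_n -> seq 'I_n) (w : nat),
      symmetric e -> irreflexive e -> triangle_free e ->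
      adjacency_lists e adj ->
      (c * (trunc_log 2 n).+1 <= w)%N ->
      let s := run w P (encode adj) (T n) in
      halted P s /\
      (girth_approx e (8 / 5) (reg s 0) \/ acyclic e /\ reg s 0%N = 0%N).
Proof.
have [C HC] := main_time_bound.
exists (link main), 20%N,
  (fun n => C * ((trunc_log 2 n).+1 * (n.+1 * root12_floor n ^ 11)) + 10)%N.
split; first by apply: time_asymptotics; lra.
move=> n e adj w e_sym e_irr e_free Hadj Hw s.
have [W1 W2] := word_bound Hw.
have IG := encode_input_graph e_sym e_irr Hadj.
have base_W : ((n + 2) ^ 2 < 2 ^ w)%N by lia.
have [s' Hexec [Hans [Hout [b [h [b0 Hn Hb Hh Hclk]]]]]] := main_spec IG W2 W1.
have Ht : (clk s' + 7 <= C * ((trunc_log 2 n).+1 * (n.+1 * root12_floor n ^ 11)) + 10)%N.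
  have := HC n b h b0 Hn Hh; have Hbr := leq_root12_floor Hb.
  have : (C * ((trunc_log 2 n).+1 * (n.+1 * b ^ 11)) <=
    C * ((trunc_log 2 n).+1 * (n.+1 * root12_floor n ^ 11)))%N.
    by rewrite !leq_mul // leq_exp2r.
  by lia.
have Hin a : (nth 0 (encode adj) a < 2 ^ w)%N by have := encode_lt e_sym e_irr Hadj a; lia.
have H0 : nth 0%N (encode adj) 0 = n by [].
have [|Hhalt Hreg] := link_run base_W H0 (size_encode e_sym e_irr Hadj) Hin Hexec _ Ht.
  by apply: leq_ltn_trans Hout _; lia.
split; first exact: Hhalt.
by rewrite Hreg; apply: answer_correct.
Qed.
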